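(* Let $p\in(0,1]$ and let $A$ be a real associative algebra. Let $q:A\to[0,\infty)$ be a $p$-homogeneous seminorm on $A$ with the square property, i.e. $q(a^2)=q(a)^2$ for all $a\in A$. Then $q$ is submultiplicative, i.e. $q(ab)\le q(a)q(b)$ for all $a,b\in A$, and $q^{1/p}$ is a submultiplicative seminorm on $A$.
   Context: For $p\in(0,1]$, a $p$-homogeneous seminorm on a real algebra $A$ is a map $q:A\to[0,\infty)$ with $q(a+b)\le q(a)+q(b)$ and $q(\alpha a)=|\alpha|^p q(a)$ for all $a,b\in A$, $\alpha\in\mathbb{R}$. A $1$-homogeneous seminorm is called a seminorm. A function $q:A\to[0,\infty)$ is called submultiplicative if $q(ab)\le q(a)q(b)$ for all $a,b\in A$. The algebra $A$ is not assumed to be unital or commutative, and $q$ is not assumed submultiplicative. *)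

(* Defs.v *)
From mathcomp Require Import all_boot all_order all_algebra.
From mathcomp Require Import all_classical all_reals all_analysis.

Set Implicit Arguments.
Unset Strict Implicit.
Unset Printing Implicit Defensive.

Import Order.TTheory GRing.Theory Num.Theory.
Local Open Scope ring_scope.

(* MathComp algebras are unital. A not necessarily unital or commutative real
   associative algebra is therefore given by a left module A over R : realType
   together with an associative bilinear map mul : {bilinear A -> A -> A};
   the definitions below only mention the underlying function of mul. *)

(* The exponent p is meant to lie in ]0, 1]; in particular 0 `^ p = 0. *)
Record homogeneous_seminorm (R : realType) (p : R) (A : lmodType R)
    (q : A -> R) : Prop := HomogeneousSeminorm {
  hseminorm_ge0 : forall a, 0 <= q a ;
  hseminormD : forall a b, q (a + b) <= q a + q b ;
  hseminormZ : forall (x : R) a, q (x *: a) = `|x| `^ p * q a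
}.

Definition seminorm (R : realType) (A : lmodType R) (q : A -> R) : Prop :=
  homogeneous_seminorm 1 q.

Definition square_property (R : realType) (A : lmodType R)
    (mul : A -> A -> A) (q : A -> R) : Prop :=
  forall a, q (mul a a) = q a ^+ 2.

Definition submultiplicative (R : realType) (A : lmodType R)
    (mul : A -> A -> A) (q : A -> R) : Prop :=
  forall a b, q (mul a b) <= q a * q b.

(* Main.v *)
Require Import Defs.
From HB Require Import structures.
From mathcomp Require Import all_boot all_order all_algebra.
From mathcomp Require Import all_classical all_reals all_analysis.
From mathcomp Require Import zify ring lra.

Set Implicit Arguments.
Unset Strict Implicit.
Unset Printing Implicit Defensive.

Import Order.TTheory GRing.Theory Num.Theory.
Local Open Scope ring_scope.
Local Open Scope classical_set_scope.

(** Put [N x = q x `^ p^-1]. Then [N] is homogeneous of degree 1, [N (x ^ 2)] is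
    [N x ^ 2], and on a sum of [m] terms [N] is at most [m ^ e] times its largest
    value on them, for every [e >= 1 / p]. The two assertions are that [N] is
    submultiplicative and subadditive. A factor that is constant or polynomial in
    [n] disappears from an inequality between [n]-th powers ([le_of_exp_le]), so
    estimates are only needed up to such factors.

    Up to a constant, [N] is submultiplicative ([square_quasi_norm]): the Jordan
    product [ab + ba] is a combination of squares, hence bounded; so is [bab], a
    combination of Jordan products; and [(ab - ba)^2 + (ab + ba)^2] is
    [2 (a (bab) + (bab) a)], so the square property bounds [ab - ba] too.

    The guiding picture is that [A], modulo the kernel of [N], is an algebra of
    functions with values in the quaternions and that [N] is the supremum of the
    modulus, which is multiplicative on quaternions. No such representation is
    constructed. A point is replaced by a quasi-norm that was localized finitely
    many times: when [c] has growth rate [rho], the upper limit of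
    [N (c ^ n z) / rho ^ n] is a quasi-norm of the same kind with another constant
    ([localize_quasi_norm]). In the picture it only sees the points at which [c]
    has maximal modulus. What makes it work without commutativity is that
    [N (x y)] and [N (y x)] are comparable ([qn_cyclic]), because the powers of
    [x y] and of [y x] are.

    Two localizations make an element [a] of growth rate [alpha] quadratic:
    [a^2 - s a + alpha^2] is in the kernel for some real [s]
    ([quadratic_localization]). Localize at [a], put [u = a / alpha], then localize
    at [1 + u]: now [u] and [1 + u] multiply the quasi-norm by [1] and by some [g].
    In the picture the spectrum of [u] lies on two circles with real centres, so it
    consists of two conjugate points. The formal substitute for this is
    [parallelogram_bound]: if [v] and [w] commute and have bounded powers and
    [t v + (1 - t) w] multiplies the quasi-norm by [rho], then the growth rate [d]
    of [v - w] satisfies [rho^2 + t (1 - t) d^2 <= 1]. It is the parallelogram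
    identity for the l2 norm of the coefficients of polynomials in [v] and [w].

    For [N (a b) <= N a * N b], localize at [a b] and make [a b], [a], [b] and
    [a + b] quadratic. Modulo the kernel either [a] and [b] commute, and then
    [(a b) ^ n] is [a ^ n b ^ n], or they generate a quaternion algebra
    ([quaternion_anticommutator]), in which the norm of [a b] is the product
    [alpha^2 beta^2] of the norms of [a] and [b]. The quadratic equation of [a b] is
    unique, so the growth rate of [a b], which is at least [N (a b)], equals
    [alpha beta <= N a * N b]. For the triangle inequality localize at [a + b]. In
    the commuting case the binomial formula suffices; otherwise the norm form of
    the quaternion algebra is nonnegative on [a + r b] for a well chosen [r], which
    gives the Cauchy-Schwarz inequality for it. *)

(** * Comparison of powers and upper limits *)

Section Growth.
Variable R : realType.
Implicit Types (x y C : R) (u v : nat -> R).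

Lemma bernoulli_ineq (h : R) n : 0 <= h -> 1 + n%:R * h <= (1 + h) ^+ n.
Proof.
move=> h0; elim: n => [|n IHn]; first by rewrite mul0r addr0 expr0.
rewrite exprS; apply: le_trans (ler_wpM2l _ IHn); last by rewrite addr_ge0.
rewrite -natr1; have := mulr_ge0 (ler0n R n) (mulr_ge0 h0 h0); lra.
Qed.

Lemma exp_gt_poly (C : R) e (h : R) : 0 < h ->
  exists m, forall n, (m <= n)%N -> C * n.+1%:R ^+ e < (1 + h) ^+ n.
Proof.
move=> h0; pose D := (e.+1 * 2)%N.
(* write n = m (e + 1) + r; Bernoulli gives (1 + h)^n >= (m h)^(e + 1), one power
   of m more than the right-hand side can reach *)
pose M := Num.bound (`|C| * D%:R ^+ e / h ^+ e.+1).
exists (e.+1 * M.+1)%N => n le_n; pose m := (n %/ e.+1)%N.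
have le_Mm : (M.+1 <= m)%N by rewrite leq_divRL // mulnC.
have m_gt0 : (0 < m)%N by apply: leq_trans le_Mm.
have le_nm : (n.+1 <= D * m)%N.
  have : (n < m.+1 * e.+1)%N by rewrite ltn_ceil.
  by rewrite /D; nia.
have le_mn : (m * e.+1 <= n)%N by rewrite leq_trunc_div.
apply: (@lt_le_trans _ _ ((1 + h) ^+ (m * e.+1))); last first.
  by apply: ler_weXn2l => //; rewrite lerDl ltW.
rewrite exprM; apply: (@lt_le_trans _ _ ((m%:R * h) ^+ e.+1)); last first.
  have le_b : m%:R * h <= (1 + h) ^+ m.
    by apply: le_trans (bernoulli_ineq m (ltW h0)); rewrite lerDr.
  have mh0 : 0 <= m%:R * h by rewrite mulr_ge0 ?ler0n// ltW.
  by apply: lerXn2r => //; rewrite nnegrE // (le_trans mh0).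
apply: (@le_lt_trans _ _ (`|C| * (D * m)%:R ^+ e)).
  apply: (@le_trans _ _ (`|C| * n.+1%:R ^+ e)).
    by rewrite ler_wpM2r ?exprn_ge0 ?ler0n// ler_norm.
  by rewrite ler_wpM2l// lerXn2r ?nnegrE ?ler0n// ler_nat.
rewrite natrM !exprMn [m%:R ^+ e.+1]exprS [h ^+ e.+1 in ltRHS]exprS.
have : `|C| * D%:R ^+ e / h ^+ e.+1 < m%:R.
  apply: lt_le_trans (archi_boundP _) _.
    by rewrite divr_ge0 ?mulr_ge0 ?exprn_ge0 // ltW.
  by rewrite ler_nat ltnW.
rewrite ltr_pdivrMr ?exprn_gt0// => lt_C.
have -> : m%:R * m%:R ^+ e * (h * h ^+ e) = m%:R * h ^+ e.+1 * m%:R ^+ e.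
  by rewrite exprS; ring.
by rewrite mulrA ltr_pM2r ?exprn_gt0 ?ltr0n.
Qed.

(** It is enough to know the inequality for arbitrarily large exponents: the square
    property gives it along the powers of two. *)
Lemma le_of_exp_le (x y C : R) e : 0 <= x -> 0 <= y ->
  (forall m, exists2 n, (m <= n)%N & x ^+ n <= C * n.+1%:R ^+ e * y ^+ n) ->
  x <= y.
Proof.
move=> x0 y0 xy; rewrite leNgt; apply/negP => lt_yx.
have [y_eq0|] := eqVneq y 0.
  have [[|n]// _] := xy 1%N; rewrite y_eq0 expr0n mulr0.
  by apply/negP; rewrite -ltNge exprn_gt0// -y_eq0.
move=> yn0; have y_gt0 : 0 < y by rewrite lt_neqAle eq_sym yn0.
have h0 : 0 < x / y - 1 by rewrite subr_gt0 ltr_pdivlMr// mul1r.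
have [m] := exp_gt_poly C e h0; have [n le_mn le_x] := xy m.
move=> /(_ n le_mn); rewrite addrC subrK expr_div_n.
by rewrite ltr_pdivlMr ?exprn_gt0// ltNge le_x.
Qed.

(** The infimum of the eventual upper bounds makes sense for sequences that are
    bounded from some rank on only; the first terms of the sequences used in
    localizations need not obey any bound. *)
Definition limsup u : R := inf [set B | \forall n \near \oo, u n <= B].

Lemma limsup_le u (B : R) : (forall n, 0 <= u n) ->
  (\forall n \near \oo, u n <= B) -> limsup u <= B.
Proof.
move=> u0 uB; apply: ge_inf => //; exists 0 => D uD.
by have [n ?] := filter_ex uD; apply: le_trans (u0 n) _.
Qed.

Lemma limsup_ge u (B : R) : (exists D, \forall n \near \oo, u n <= D) ->
  (forall m, exists2 n, (m <= n)%N & B <= u n) -> B <= limsup u.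
Proof.
move=> bu Bu; apply: lb_le_inf => // D [m _ uD].
by have [n /uD ? /le_trans] := Bu m; apply.
Qed.

Lemma limsup_lt u (B : R) : (exists D, \forall n \near \oo, u n <= D) ->
  limsup u < B -> \forall n \near \oo, u n <= B.
Proof.
move=> bu /(inf_lt bu)[D uD /ltW DB].
by apply: filterS uD => n /le_trans; apply.
Qed.

Lemma limsup_ge0 u : (exists D, \forall n \near \oo, u n <= D) ->
  (forall n, 0 <= u n) -> 0 <= limsup u.
Proof. by move=> bu u0; apply: limsup_ge => // m; exists m. Qed.

Lemma near_shift (P : set nat) d :
  (\forall n \near \oo, P n) -> \forall n \near \oo, P (n + d)%N.
Proof.
move=> [m _ mP]; exists m => // n /= mn; apply: mP;
  exact: leq_trans mn (leq_addr _ _).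
Qed.

(** Two different shifts [d] and [d'] are allowed so that one statement gives both
    inequalities in the exact rule for a limit of shifted sequences. *)
Lemma limsup_leZ u v (r : R) d d' : (exists D, \forall n \near \oo, v n <= D) ->
  (forall n, 0 <= u n) -> (forall n, 0 <= v n) -> 0 <= r ->
  (\forall n \near \oo, r * u (n + d)%N <= v (n + d')%N) ->
  r * limsup u <= limsup v.
Proof.
move=> bv u0 v0; rewrite le_eqVlt => /predU1P[<- _|r0 uv].
  by rewrite mul0r limsup_ge0.
apply/ler_addgt0Pr => eps eps0; rewrite mulrC -ler_pdivlMr//.
have /near_shift : \forall n \near \oo, v n <= limsup v + eps.
  by apply: limsup_lt => //; rewrite ltrDl.
move=> /(_ d') vB; apply: limsup_le => //.
have [m _ mP] : \forall n \near \oo, u (n + d)%N <= (limsup v + eps) / r.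
  apply: filterS2 uv vB => n uvn vn.
  by rewrite ler_pdivlMr// mulrC (le_trans uvn).
by exists (m + d)%N => // n /= dn; rewrite -(@subnK d n) ?mP//=; lia.
Qed.

Lemma le_mul_approx (k x y z : R) : 0 <= k -> 0 <= x -> 0 <= y ->
  (forall a b, x < a -> y < b -> z <= k * a * b) -> z <= k * x * y.
Proof.
move=> k0 x0 y0 H; rewrite leNgt; apply/negP => lt_z.
pose h := Num.min 1 ((z - k * x * y) / (1 + k * (x + y + 1))).
have den0 : 0 < 1 + k * (x + y + 1) by rewrite ltr_pwDl// mulr_ge0// !addr_ge0.
have h0 : 0 < h by rewrite lt_min ltr01 divr_gt0// subr_gt0.
have h1 : h <= 1 by rewrite ge_min lexx.
have h2 : h * (1 + k * (x + y + 1)) <= z - k * x * y.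
  by rewrite -ler_pdivlMr// ge_min lexx orbT.
have := H (x + h) (y + h); rewrite !ltrDl h0 => /(_ isT isT).
have : k * h * h <= k * h by rewrite ler_piMr// mulr_ge0// ltW.
nra.
Qed.

End Growth.

(** * Unitization and linear identities between words *)

(** The associativity proof is a parameter so that the ring structure below can be
    attached to the type itself. *)
Definition unitization (R : realType) (A : lmodType R)
  (mul : {bilinear A -> A -> A}) (_ : associative mul) : Type := (R * A)%type.

Section Unitization.
Variables (R : realType) (A : lmodType R) (mul : {bilinear A -> A -> A}).
Variable mulA : associative mul.
Local Notation U := (unitization mulA).

HB.instance Definition _ := GRing.Lmodule.on U.

Let uone : U := (1, 0).
Let umul (x y : U) : U := (x.1 * y.1, x.1 *: y.2 + y.1 *: x.2 + mul x.2 y.2).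

Fact umulA : associative umul.
Proof.
move=> [r a] [s b] [t c]; rewrite /umul /=; congr pair; first exact: mulrA.
rewrite !linearDr !linearDl /= !linearZl_LR !linearZr_LR /= mulA !scalerDr.
rewrite !scalerA (mulrC t r) (mulrC t s) -!addrA; congr (_ + (_ + _)).
rewrite addrCA; congr (_ + _); rewrite [RHS]addrCA; congr (_ + _).
exact: addrCA.
Qed.

Fact umul1l : left_id uone umul.
Proof.
by move=> [r a]; rewrite /umul /= mul1r scale1r scaler0 linear0l !addr0.
Qed.

Fact umul1r : right_id uone umul.
Proof.
by move=> [r a]; rewrite /umul /= mulr1 scale1r scaler0 linear0r add0r addr0.
Qed.

Fact umulDl : left_distributive umul +%R.
Proof.
move=> [r a] [s b] [t c]; rewrite /umul /=; congr pair; first exact: mulrDl.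
rewrite linearDl scalerDl scalerDr /= -!addrA; congr (_ + _).
rewrite addrCA; congr (_ + _); rewrite [RHS]addrCA; congr (_ + _).
exact: addrCA.
Qed.

Fact umulDr : right_distributive umul +%R.
Proof.
move=> [r a] [s b] [t c]; rewrite /umul /=; congr pair; first exact: mulrDr.
rewrite linearDr scalerDl scalerDr /= -!addrA; congr (_ + _).
rewrite addrCA; congr (_ + _); rewrite [RHS]addrCA; congr (_ + _).
exact: addrCA.
Qed.

Fact uone_neq0 : uone != 0.
Proof. by rewrite -pair_eqE /= oner_eq0. Qed.

HB.instance Definition _ := GRing.Zmodule_isNzRing.Build U
  umulA umul1l umul1r umulDl umulDr uone_neq0.

Fact uscaleAl (t : R) (x y : U) : t *: (x * y) = t *: x * y.
Proof.
case: x y => [r a] [s b]; apply: injective_projections => /=.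
  exact: mulrA.
rewrite linearZl_LR /= !scalerDr !scalerA; congr (_ + _ *: _ + _).
exact: mulrC.
Qed.

HB.instance Definition _ := GRing.Lmodule_isLalgebra.Build R U uscaleAl.

Fact uscaleAr (t : R) (x y : U) : t *: (x * y) = x * (t *: y).
Proof.
case: x y => [r a] [s b]; apply: injective_projections => /=.
  exact: mulrCA.
rewrite linearZr_LR /= !scalerDr !scalerA; congr (_ *: _ + _ + _).
exact: mulrC.
Qed.

HB.instance Definition _ := GRing.Lalgebra_isAlgebra.Build R U uscaleAr.

End Unitization.

Section SquareZero.
Variables (R : realType) (A : lmodType R).

(** The square-zero extension of a module [A]. It is a commutative ring containing
    [A] as a module, so an identity between linear combinations in [A] may be
    proved there by [ring], with the vectors as indeterminates. *)
Definition zero_mul (_ _ : A) : A := 0.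

Fact zero_mul_bilinear : bilinear_for *:%R *:%R zero_mul.
Proof.
split=> u a x y; rewrite /= /zero_mul; apply: esym; rewrite -[RHS]addr0;
  congr (_ + _); exact: scaler0.
Qed.

HB.instance Definition _ := bilinear_isBilinear.Build R A A A *:%R *:%R
  zero_mul zero_mul_bilinear.

Fact zero_mulA : associative zero_mul. Proof. by []. Qed.

Definition square_zero : Type :=
  unitization (zero_mulA : associative (zero_mul : {bilinear A -> A -> A})).
HB.instance Definition _ := GRing.Algebra.on square_zero.

Fact square_zero_mulC : commutative (@GRing.mul square_zero).
Proof.
move=> [r a] [s b]; apply: injective_projections; rewrite /= ?(mulrC r)//.
by rewrite (addrC (r *: b)).
Qed.

HB.instance Definition _ :=
  GRing.PzRing_hasCommutativeMul.Build square_zero square_zero_mulC.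

Definition lift_scalar (r : R) : square_zero := (r, 0).
Definition lift_vector (a : A) : square_zero := (0, a).

Lemma lift_vector_inj : injective lift_vector. Proof. by move=> a b []. Qed.
Lemma lift_vectorD : {morph lift_vector : a b / a + b}.
Proof. by move=> a b; apply: injective_projections; rewrite //= addr0. Qed.
Lemma lift_vectorN : {morph lift_vector : a / - a}.
Proof. by move=> a; apply: injective_projections; rewrite //= oppr0. Qed.
Lemma lift_vectorZ r a : lift_vector (r *: a) = lift_scalar r * lift_vector a.
Proof.
by apply: injective_projections; rewrite /= ?mulr0// scale0r addr0 addr0.
Qed.
Lemma lift_vector0 : lift_vector 0 = 0. Proof. by []. Qed.

Fact lift_scalar_is_rmorphism : monoid_morphism lift_scalar.
Proof.
split=> // r s; apply: injective_projections => //=.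
by rewrite !scaler0 !addr0.
Qed.
Fact lift_scalar_is_additive : zmod_morphism lift_scalar.
Proof. by move=> r s; apply: injective_projections; rewrite //= subrr. Qed.
HB.instance Definition _ := GRing.isZmodMorphism.Build R square_zero lift_scalar
  lift_scalar_is_additive.
HB.instance Definition _ := GRing.isMonoidMorphism.Build R square_zero lift_scalar
  lift_scalar_is_rmorphism.
End SquareZero.

(** Proves identities in a noncommutative algebra: both sides are expanded into
    linear combinations of words, which are then compared as vectors. *)
Ltac alg_ring :=
  repeat progress rewrite ?(expr2, mulrDl, mulrDr, mulNr, mulrN, opprK, mulrA,
    mul1r, mulr1, mul0r, mulr0, =^~ scalerAl, =^~ scalerAr, scalerDr, scalerN,
    scaler0);
  apply: lift_vector_inj;
  rewrite ?(lift_vectorD, lift_vectorN, lift_vectorZ, lift_vector0); ring.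

(** * Quasi-norms that are submultiplicative up to a constant *)

Section QuasiNorms.
Variables (R : realType) (U : algType R).
Implicit Types (I : set U) (N : U -> R) (x y z : U).

Record two_sided_ideal I : Prop := TwoSidedIdeal {
  ideal_add : forall x y, I x -> I y -> I (x + y) ;
  ideal_scale : forall (r : R) x, I x -> I (r *: x) ;
  ideal_mull : forall x y, I y -> I (x * y) ;
  ideal_mulr : forall x y, I x -> I (x * y)
}.

(** The seminorm inequality is kept in the form [qn_sum], which suits the [1 / p]-th
    root of a [p]-homogeneous seminorm; it costs a factor polynomial in the number
    of terms. The conditions are confined to an ideal [I] because the given seminorm
    lives on [A], an ideal of its unitization, whereas localizations live on the
    whole unitization. *)
Record quasi_norm I (K : R) (e : nat) N : Prop := QuasiNorm {
  qn_ge1 : 1 <= K ;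
  qn_ge0 : forall x, 0 <= N x ;
  qnZ : forall (r : R) x, I x -> N (r *: x) = `|r| * N x ;
  qn_sum : forall m (f : nat -> U) B,
    (forall i, (i <= m)%N -> I (f i) /\ N (f i) <= B) ->
    N (\sum_(i < m.+1) f i) <= m.+1%:R ^+ e * B ;
  qnM : forall x y, I x -> I y -> N (x * y) <= K * N x * N y ;
  qn_sqr : forall x, I x -> N x ^+ 2 <= K * N (x ^+ 2)
}.

(** Such a [rho] is the spectral radius of [x], but the two bounds are sharper than
    the convergence of the [n]-th roots of [N (x ^+ n)]. *)
Definition growth_rate N x (rho : R) := exists2 C, 0 < C &
  forall n, (0 < n)%N ->
    rho ^+ n <= C * N (x ^+ n) /\ N (x ^+ n) <= C * rho ^+ n.

Lemma ideal_exp I x n : two_sided_ideal I -> I x -> (0 < n)%N -> I (x ^+ n).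
Proof. by case: n => // n iI Ix _; rewrite exprS; apply: ideal_mulr. Qed.

Lemma ideal_setT : two_sided_ideal [set: U].
Proof. by []. Qed.

Section Theory.
Variables (I : set U) (K : R) (e : nat) (N : U -> R).
Hypotheses (iI : two_sided_ideal I) (qN : quasi_norm I K e N).

Let K_gt0 : 0 < K. Proof. exact: lt_le_trans (qn_ge1 qN). Qed.
Let K_ge0 : 0 <= K. Proof. exact: ltW. Qed.
Let N0 x : 0 <= N x. Proof. exact: qn_ge0 qN x. Qed.
Hint Resolve K_gt0 K_ge0 N0 : core.

Lemma qnD x y B : I x -> I y -> N x <= B -> N y <= B -> N (x + y) <= 2 ^+ e * B.
Proof.
move=> Ix Iy xB yB.
have := qn_sum qN (m := 1) (f := fun i => if i is 0%N then x else y) (B := B).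
by rewrite !big_ord_recl big_ord0 /= addr0; apply; case.
Qed.

Lemma qn_le_expn x n : I x -> (0 < n)%N -> N (x ^+ n) <= (K * N x) ^+ n.
Proof.
move=> Ix; case: n => // n _; elim: n => [|n IHn].
  by rewrite !expr1 ler_peMl// (qn_ge1 qN).
rewrite exprS [leRHS]exprS; apply: le_trans (qnM qN Ix _) _.
  exact: ideal_exp.
by rewrite ler_wpM2l// mulr_ge0.
Qed.

Lemma qn_expn2_le x j : I x ->
  N x ^+ (2 ^ j) <= K ^+ (2 ^ j) * N (x ^+ (2 ^ j)).
Proof.
(* the induction needs the exponent 2 ^ j - 1 of K, hence the extra factor K *)
move=> Ix; suff : K * N x ^+ (2 ^ j) <= K ^+ (2 ^ j) * N (x ^+ (2 ^ j)).
  by apply: le_trans; rewrite ler_peMl ?exprn_ge0// (qn_ge1 qN).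
elim: j => [|j IHj]; first by rewrite expn0 !expr1.
rewrite expnSr !exprM; set y := x ^+ (2 ^ j) in IHj *.
have Iy : I y by apply: ideal_exp; rewrite ?expn_gt0.
have := qn_sqr qN Iy; move: IHj (N0 (y ^+ 2)); set a := N x ^+ _; set b := K ^+ _.
have a0 : 0 <= a by rewrite exprn_ge0.
have b0 : 0 <= b by rewrite exprn_ge0.
move=> ab _ yy; rewrite -(ler_pM2l K_gt0).
apply: (@le_trans _ _ ((b * N y) ^+ 2)).
  by rewrite mulrA -expr2 -exprMn; apply: lerXn2r; rewrite ?nnegrE ?mulr_ge0.
by rewrite exprMn [leRHS]mulrCA ler_wpM2l ?exprn_ge0.
Qed.

(** The powers satisfy [(xy)^n = (xyx) (yx)^(n-3) (yxy)], so [xy] does not grow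
    faster than [yx]; and a quasi-norm is comparable to the growth of powers. *)
Lemma qn_cyclic x y : I x \/ I y -> N (x * y) <= K ^+ 2 * N (y * x).
Proof.
move=> Ixy.
have Ixyl : I (x * y) by case: Ixy => ?; [exact: ideal_mulr | exact: ideal_mull].
have Iyxl : I (y * x) by case: Ixy => ?; [exact: ideal_mull | exact: ideal_mulr].
have I3 z : I (x * y * z) /\ I (y * x * z) by split; apply: ideal_mulr.
pose t := K * N (y * x).
pose C := K ^+ 2 * N (x * y * x) * N (y * x * y).
have C0 : 0 <= C by rewrite !mulr_ge0 ?exprn_ge0.
have t0 : 0 <= t by rewrite mulr_ge0.
have bnd n : (3 < n)%N -> N ((x * y) ^+ n) <= C * t ^+ (n - 3).
  move=> n3.
  have -> : (x * y) ^+ n = (x * y * x) * (y * x) ^+ (n - 3) * (y * x * y).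
    have shift k : (x * y) ^+ k * x = x * (y * x) ^+ k.
      elim: k => [|k IHk]; first by rewrite !expr0 mul1r mulr1.
      by rewrite exprS -mulrA IHk exprS !mulrA.
    have {1}-> : n = ((n - 3).+2.+1)%N by lia.
    rewrite -mulrA (mulrA (_ ^+ _)) -exprSr -[x * y * x]mulrA.
    rewrite -(mulrA x) (mulrA (y * x)) -exprS (mulrA x) -shift.
    by rewrite -mulrA -exprSr.
  have Im : I ((y * x) ^+ (n - 3)) by apply: ideal_exp => //; lia.
  apply: le_trans (qnM qN _ (I3 y).2) _; first by apply: ideal_mull.
  have -> : C * t ^+ (n - 3) =
      K * (K * N (x * y * x) * t ^+ (n - 3)) * N (y * x * y) by rewrite /C; ring.
  apply: ler_wpM2r => //; apply: ler_wpM2l => //.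
  apply: le_trans (qnM qN (I3 x).1 Im) _; apply: ler_wpM2l; first exact: mulr_ge0.
  by apply: qn_le_expn => //; lia.
rewrite expr2 -mulrA -/t; clearbody C t.
apply: (@le_of_exp_le _ _ _ (C / t ^+ 3) 0); rewrite ?mulr_ge0// => m.
exists (2 ^ m.+2)%N.
  by apply/ltnW/(ltn_trans (ltn_expl m (ltnSn 1))); rewrite ltn_exp2l// ltnW.
rewrite expr0 mulr1; apply: le_trans (qn_expn2_le _ Ixyl) _.
have m3 : (3 < 2 ^ m.+2)%N by rewrite (@leq_exp2l 2 2).
rewrite [(K * t) ^+ _]exprMn [leRHS]mulrCA ler_wpM2l ?exprn_ge0//.
apply: le_trans (bnd _ m3) _; have [->|tn0] := eqVneq t 0.
  by rewrite !expr0n subn_eq0 leqNgt m3 expn_eq0 /= !mulr0.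
by rewrite -mulrA ler_wpM2l// mulrC -expfB.
Qed.

(** The numbers [(K * N (x ^+ 2 ^ j)) `^ (2 ^ j)^-1] decrease with [j], and their
    infimum is the rate; [qn_sqr] prevents it from dropping by more than a
    constant. *)
Lemma growth_rate_exists x : I x -> exists2 rho, 0 <= rho & growth_rate N x rho.
Proof.
move=> Ix; pose a j := K * N (x ^+ (2 ^ j)).
have a0 j : 0 <= a j by rewrite mulr_ge0.
pose f j := a j `^ (2 ^ j)%:R^-1.
have f0 j : 0 <= f j by exact: powR_ge0.
have fE j : f j ^+ (2 ^ j) = a j.
  by rewrite -powR_mulrn// -powRrM mulVf ?powRr1// pnatr_eq0 expn_eq0.
pose F := range f; pose rho := inf F.
have F_lb : has_lbound F by exists 0 => _ [j _ <-].
have F0 : F !=set0 by exists (f 0%N), 0%N.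
have rho0 : 0 <= rho by apply: lb_le_inf => // _ [j _ <-].
have rho_le j : rho <= f j by apply: ge_inf => //; exists j.
have up n : (0 < n)%N -> N (x ^+ n) <= K * rho ^+ n.
  move=> n0; rewrite mulrC -ler_pdivrMr//.
  have Nf j : N (x ^+ n) / K <= f j ^+ n.
    apply: (@le_of_exp_le _ _ _ 1 0); rewrite ?exprn_ge0 ?divr_ge0// => m.
    exists (2 ^ (j + m))%N.
      by rewrite (leq_trans (ltnW (ltn_expl m (ltnSn 1))))// leq_exp2l// leq_addl.
    rewrite expr0 mul1r mul1r expr_div_n ler_pdivrMr ?exprn_gt0//.
    have Ixn := ideal_exp iI Ix n0.
    rewrite mulrC; apply: le_trans (qn_expn2_le _ Ixn) _.
    rewrite ler_wpM2l ?exprn_ge0// -!exprM.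
    have -> : (n * 2 ^ (j + m) = 2 ^ j * (2 ^ m * n))%N by rewrite expnD; lia.
    rewrite [x ^+ _]exprM [f j ^+ _]exprM fE; apply: qn_le_expn.
      by apply: ideal_exp => //; rewrite expn_gt0.
    by rewrite muln_gt0 expn_gt0.
  have Nn0 : 0 <= N (x ^+ n) / K by rewrite divr_ge0.
  pose r := (N (x ^+ n) / K) `^ n%:R^-1.
  have rE : r ^+ n = N (x ^+ n) / K.
    by rewrite -powR_mulrn ?powR_ge0// -powRrM mulVf ?powRr1// pnatr_eq0 -lt0n.
  rewrite -rE; apply: lerXn2r; rewrite ?nnegrE ?powR_ge0//.
  apply: lb_le_inf => // _ [j _ <-].
  by rewrite -(ler_pXn2r n0) ?nnegrE ?powR_ge0// rE.
exists rho => //; exists (K ^+ 3); first exact: exprn_gt0.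
have K_le : K <= K ^+ 3 by rewrite -[leLHS]expr1 ler_weXn2l ?(qn_ge1 qN).
move=> n n0; split; last first.
  by apply: le_trans (up n n0) _; rewrite ler_wpM2r ?exprn_ge0.
have [->|rhon0] := eqVneq rho 0.
  by rewrite expr0n eqn0Ngt n0 /= mulr_ge0 ?exprn_ge0.
have rho_gt0 : 0 < rho by rewrite lt_neqAle eq_sym rhon0.
have lt_n : (n < 2 ^ n)%N by rewrite ltn_expl.
have m0 : (0 < 2 ^ n - n)%N by rewrite subn_gt0.
rewrite -(ler_pM2r (exprn_gt0 (2 ^ n - n) rho_gt0)) -exprD subnKC ?(ltnW lt_n)//.
apply: (@le_trans _ _ (a n)).
  by rewrite -fE; apply: lerXn2r; rewrite ?nnegrE.
rewrite /a -[in leLHS](subnKC (ltnW lt_n)) exprD.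
rewrite 2!exprS expr1 -!mulrA; apply: ler_wpM2l => //.
apply: le_trans (qnM qN _ _) _; try exact: ideal_exp.
rewrite -mulrA; apply: ler_wpM2l => //; rewrite mulrCA.
by apply: ler_wpM2l => //; exact: up.
Qed.

End Theory.
End QuasiNorms.

(** * From the square property to a quasi-norm *)

Section JordanBound.
Variables (R : realType) (U : algType R) (I : set U) (e : nat) (N : U -> R).
Hypotheses (iI : two_sided_ideal I) (N0 : forall x, 0 <= N x).
Hypothesis NZ : forall (r : R) x, I x -> N (r *: x) = `|r| * N x.
Hypothesis N_sum : forall m (f : nat -> U) B,
  (forall i, (i <= m)%N -> I (f i) /\ N (f i) <= B) ->
  N (\sum_(i < m.+1) f i) <= m.+1%:R ^+ e * B.
Hypothesis N_sqr : forall x, I x -> N (x ^+ 2) = N x ^+ 2.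
Implicit Types (a b x y : U).

Let c : R := 2 ^+ e.
Let c1 : 1 <= c. Proof. by rewrite exprn_ege1// ler1n. Qed.
Let cX1 n : 1 <= c ^+ n. Proof. exact: exprn_ege1. Qed.
Let cX0 n : 0 <= c ^+ n. Proof. exact: le_trans (cX1 n). Qed.
Let c0 : 0 <= c. Proof. exact: le_trans c1. Qed.

Let ND x y B : I x -> I y -> N x <= B -> N y <= B -> N (x + y) <= c * B.
Proof.
move=> Ix Iy xB yB.
have := N_sum (m := 1) (f := fun i => if i is 0%N then x else y) (B := B).
by rewrite !big_ord_recl big_ord0 /= addr0; apply; case.
Qed.

Let Iopp x : I x -> I (- x).
Proof. by move=> Ix; rewrite -scaleN1r; exact: (ideal_scale iI). Qed.

Let NN x : I x -> N (- x) = N x.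
Proof. by move=> Ix; rewrite -scaleN1r NZ// normrN1 mul1r. Qed.

Let NB x y B : I x -> I y -> N x <= B -> N y <= B -> N (x - y) <= c * B.
Proof. by move=> Ix Iy xB yB; apply: ND => //; [exact: Iopp | rewrite NN]. Qed.

Let IM x y : I x -> I (x * y). Proof. exact: (ideal_mulr iI). Qed.
Let IJ x y : I x -> I y -> I (x * y + y * x).
Proof. by move=> Ix Iy; apply: (ideal_add iI); exact: IM. Qed.

Lemma jordan_bound1 a b : I a -> I b -> N a <= 1 -> N b <= 1 ->
  N (a * b + b * a) <= c ^+ 3.
Proof.
move=> Ia Ib a1 b1.
have -> : a * b + b * a = (a + b) ^+ 2 - (a ^+ 2 + b ^+ 2) by alg_ring.
have Iab : I (a + b) by exact: (ideal_add iI).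
have N1 x : I x -> N x <= 1 -> I (x ^+ 2) /\ N (x ^+ 2) <= 1.
  by move=> Ix x1; split; [exact: IM | rewrite N_sqr// exprn_ile1].
have [[Ia2 a2] [Ib2 b2]] := (N1 _ Ia a1, N1 _ Ib b1).
have ab_le : N (a + b) <= c by rewrite -[c]mulr1; exact: ND.
rewrite exprS; apply: NB; first exact: IM.
- exact: (ideal_add iI).
- by rewrite N_sqr// lerXn2r ?nnegrE.
- apply: (@le_trans _ _ (c * 1)); first exact: ND.
  exact: ler_wpM2l.
Qed.

Lemma jordan_bound a b (A B : R) : I a -> I b -> 0 < A -> 0 < B ->
  N a <= A -> N b <= B -> N (a * b + b * a) <= c ^+ 3 * (A * B).
Proof.
move=> Ia Ib A0 B0 aA bB.
have N_le1 x (X : R) : I x -> 0 < X -> N x <= X -> I (X^-1 *: x) /\ N (X^-1 *: x) <= 1.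
  move=> Ix X0 xX; split; first exact: (ideal_scale iI).
  by rewrite NZ// gtr0_norm ?invr_gt0// mulrC ler_pdivrMr// mul1r.
have [Ia' a1] := N_le1 _ _ Ia A0 aA; have [Ib' b1] := N_le1 _ _ Ib B0 bB.
have := jordan_bound1 Ia' Ib' a1 b1.
rewrite -!scalerAl -!scalerAr !scalerA [B^-1 * _]mulrC -scalerDr NZ; last exact: IJ.
rewrite gtr0_norm ?mulr_gt0 ?invr_gt0// -invfM mulrC ler_pdivrMr ?mulr_gt0//.
Qed.

(** The symmetric part [S] of the product is a Jordan product. The antisymmetric
    part [d] is bounded because its square is a combination of Jordan products and
    of [S ^+ 2]. *)
Lemma product_bound1 a b : I a -> I b -> N a <= 1 -> N b <= 1 ->
  N (a * b) <= c ^+ 12.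
Proof.
move=> Ia Ib a1 b1; pose S := a * b + b * a; pose d := a * b - b * a.
have IS : I S by exact: IJ.
have Id : I d by apply: (ideal_add iI); [|apply: Iopp]; exact: IM.
have cX_gt0 n : 0 < c ^+ n by exact: lt_le_trans (cX1 n).
have S_le : N S <= c ^+ 3 by exact: jordan_bound1.
have half x B : I x -> N (2 *: x) <= 2 * B -> N x <= B.
  by move=> Ix; rewrite NZ// ger0_norm// ler_pM2l.
have Ibab : I (b * a * b) by do 2 apply: IM.
have bab_le : N (b * a * b) <= c ^+ 7.
  apply: half => //.
  have -> : 2 *: (b * a * b) = (b * S + S * b) - (a * b ^+ 2 + b ^+ 2 * a).
    by rewrite /S; alg_ring.
  apply: (@le_trans _ _ (c * c ^+ 6)); last first.
    by rewrite -exprS ler_peMl// ler1n.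
  have Ib2 : I (b ^+ 2) by exact: IM.
  apply: NB; [exact: IJ | exact: IJ | |].
    rewrite (_ : c ^+ 6 = c ^+ 3 * (1 * c ^+ 3)); last by ring.
    exact: jordan_bound.
  apply: (@le_trans _ _ (c ^+ 3)); last by rewrite ler_weXn2l.
  by apply: jordan_bound1; rewrite // N_sqr// exprn_ile1.
have d_le : N d <= 2 * c ^+ 11.
  have k1 : 1 <= 2 * c ^+ 11 by rewrite (le_trans (cX1 11))// ler_peMl// ler1n.
  have k0 : 0 <= 2 * c ^+ 11 by exact: le_trans k1.
  rewrite -(@ler_pXn2r _ 2 isT) ?nnegrE//.
  apply: (@le_trans _ _ (2 * c ^+ 11)); last by rewrite expr2 ler_peMl.
  rewrite -N_sqr//.
  have -> : d ^+ 2 = 2 *: (a * (b * a * b) + b * a * b * a) - S ^+ 2.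
    by rewrite /d /S; alg_ring.
  rewrite [c ^+ 11]exprS mulrCA; apply: NB.
  - by apply: (ideal_scale iI); exact: IJ.
  - exact: IM.
  - rewrite NZ; last exact: IJ.
    rewrite ger0_norm// ler_pM2l// (_ : c ^+ 10 = c ^+ 3 * (1 * c ^+ 7)); last by ring.
    exact: jordan_bound.
  rewrite N_sqr//; apply: (@le_trans _ _ (c ^+ 3 ^+ 2)).
    by rewrite lerXn2r ?nnegrE.
  rewrite -exprM; apply: (@le_trans _ _ (c ^+ 10)); first by rewrite ler_weXn2l.
  by rewrite ler_peMl// ler1n.
apply: half; first exact: IM.
have -> : 2 *: (a * b) = S + d by rewrite /S /d; alg_ring.
rewrite [c ^+ 12]exprS mulrCA; apply: ND => //.
apply: le_trans S_le _; apply: (@le_trans _ _ (c ^+ 11)); first by rewrite ler_weXn2l.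
by rewrite ler_peMl// ler1n.
Qed.

Lemma square_quasi_norm : exists K, quasi_norm I K e N.
Proof.
exists (c ^+ 12); split=> //; last first.
  by move=> x Ix; rewrite N_sqr// ler_peMl// sqr_ge0.
move=> a b Ia Ib; apply: le_mul_approx => // A B aA bB.
have A0 : 0 < A by exact: le_lt_trans aA.
have B0 : 0 < B by exact: le_lt_trans bB.
have N_le1 x (X : R) : I x -> 0 < X -> N x < X -> I (X^-1 *: x) /\ N (X^-1 *: x) <= 1.
  move=> Ix X0 /ltW xX; split; first exact: (ideal_scale iI).
  by rewrite NZ// gtr0_norm ?invr_gt0// mulrC ler_pdivrMr// mul1r.
have [Ia' a1] := N_le1 _ _ Ia A0 aA; have [Ib' b1] := N_le1 _ _ Ib B0 bB.
have := product_bound1 Ia' Ib' a1 b1.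
rewrite -scalerAl -scalerAr scalerA NZ; last exact: IM.
by rewrite gtr0_norm ?mulr_gt0 ?invr_gt0// -invfM mulrC ler_pdivrMr ?mulr_gt0// mulrA.
Qed.

End JordanBound.

(** * Localization at an element *)

Section Localization.
Variables (R : realType) (U : algType R).
Implicit Types (x y z : U).

(** In an algebra of functions with the supremum norm this is the supremum over the
    points where [c] has maximal modulus, [rho] being that maximum. *)
Definition localize (N : U -> R) c rho z : R :=
  limsup (fun n => N (c ^+ n * z) / rho ^+ n).

(** What an element at which one has localized keeps under later localizations,
    even at elements that do not commute with it. *)
Definition expanding (N : U -> R) x r := exists2 eps, 0 < eps &
  forall n y, eps * r ^+ n * N y <= N (x ^+ n * y).

Variables (I : set U) (K : R) (e : nat) (N : U -> R) (c : U) (rho : R).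
Hypotheses (iI : two_sided_ideal I) (qN : quasi_norm I K e N).
Hypotheses (Ic : I c) (rho_gt0 : 0 < rho) (rateN : growth_rate N c rho).

Local Notation L := (localize N c rho).
Local Notation f z n := (N (c ^+ n * z) / rho ^+ n).

Let K_gt0 : 0 < K. Proof. exact: lt_le_trans (qn_ge1 qN). Qed.
Let K_ge0 : 0 <= K. Proof. exact: ltW. Qed.
Let N0 x : 0 <= N x. Proof. exact: qn_ge0 qN x. Qed.
Let rhoX_gt0 n : 0 < rho ^+ n. Proof. exact: exprn_gt0. Qed.
Let f0 z n : 0 <= f z n. Proof. by rewrite divr_ge0// ltW. Qed.
Hint Resolve K_gt0 K_ge0 N0 rhoX_gt0 f0 : core.

Let Icn n : (0 < n)%N -> I (c ^+ n). Proof. exact: (ideal_exp iI). Qed.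

Let Icnz n z : (0 < n)%N -> I (c ^+ n * z).
Proof. by move=> n0; apply: (ideal_mulr iI) => //; exact: Icn. Qed.

Let f_le z n B : (f z n <= B) = (N (c ^+ n * z) <= B * rho ^+ n).
Proof. exact: ler_pdivrMr. Qed.

Let f_bounded z : exists D, \forall n \near \oo, f z n <= D.
Proof.
have [C C0 NC] := rateN; exists (K * (C / rho) * N (c * z)).
exists 2%N => // n /= n2; rewrite f_le.
have -> : c ^+ n * z = c ^+ n.-1 * (c * z) by rewrite mulrA -exprSr prednK// ltnW.
apply: le_trans (qnM qN _ _) _; [by apply: Icn; lia | exact: (ideal_mulr iI)|].
have -> : K * (C / rho) * N (c * z) * rho ^+ n = K * (C * rho ^+ n.-1) * N (c * z).
  have -> : rho ^+ n = rho * rho ^+ n.-1 by rewrite -exprS prednK// ltnW.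
  field; exact: lt0r_neq0.
by rewrite ler_wpM2r// ler_wpM2l//; apply: (NC _ _).2; lia.
Qed.

Lemma localize_ge0 z : 0 <= L z.
Proof. exact: limsup_ge0. Qed.

Lemma localize_lt z B : L z < B ->
  exists m, forall n, (m < n)%N -> N (c ^+ n * z) <= B * rho ^+ n.
Proof.
move=> /limsup_lt -/(_ (f_bounded z))[m _ mP]; exists m => n mn.
by rewrite -f_le; apply: mP; exact: ltnW.
Qed.

Lemma localize_le z B m :
  (forall n, (m < n)%N -> N (c ^+ n * z) <= B * rho ^+ n) -> L z <= B.
Proof.
by move=> H; apply: limsup_le => //; exists m.+1 => // n /= mn; rewrite f_le H.
Qed.

Lemma localize_le_ideal : exists2 C, 0 < C & forall z, I z -> L z <= C * N z.
Proof.
have [C C0 NC] := rateN; exists (K * C); first exact: mulr_gt0.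
move=> z Iz; apply: (@localize_le _ _ 0) => n n0.
apply: le_trans (qnM qN (Icn n0) Iz) _.
have -> : K * C * N z * rho ^+ n = K * (C * rho ^+ n) * N z by ring.
by rewrite ler_wpM2r// ler_wpM2l//; exact: (NC _ n0).2.
Qed.

Lemma localize1_gt0 : 0 < L 1.
Proof.
have [C C0 NC] := rateN; apply: (@lt_le_trans _ _ C^-1); first by rewrite invr_gt0.
apply: limsup_ge => // m; exists m.+1 => //.
by rewrite mulr1 ler_pdivlMr// mulrC ler_pdivrMr// mulrC (NC _ _).1.
Qed.

Lemma localize_shift z : L (c * z) = rho * L z.
Proof.
have fS n : rho * f z n.+1 = f (c * z) n.
  rewrite [c ^+ n * _]mulrA -exprSr [rho ^+ n.+1]exprS; field.
  by rewrite !lt0r_neq0.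
apply/eqP; rewrite eq_le; apply/andP; split; last first.
  apply: (@limsup_leZ _ _ _ _ 1 0) => //; first exact: ltW.
  by exists 0%N => // n _ /=; rewrite addn1 addn0 fS.
rewrite mulrC -ler_pdivrMr// mulrC.
apply: (@limsup_leZ _ _ _ _ 0 1) => //; first by rewrite invr_ge0 ltW.
exists 0%N => // n _ /=; rewrite addn1 addn0 -fS mulKf//.
exact: lt0r_neq0.
Qed.

(** An element that multiplies [N] by [r] still does so after localization at an
    element commuting with it: here there is no loss of a constant. *)
Lemma localize_comm b r : 0 < r -> GRing.comm b c ->
  (forall y, I y -> N (b * y) = r * N y) -> forall z, L (b * z) = r * L z.
Proof.
move=> r0 bc Nb z.
have fb n : (0 < n)%N -> f (b * z) n = r * f z n.
  move=> n0; rewrite mulrA -(commrX n bc) -mulrA Nb ?mulrA//; exact: Icnz.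
apply/eqP; rewrite eq_le; apply/andP; split; last first.
  apply: (@limsup_leZ _ _ _ _ 0 0) => //; first exact: ltW.
  by exists 1%N => // n n0 /=; rewrite addn0 fb.
rewrite mulrC -ler_pdivrMr// mulrC.
apply: (@limsup_leZ _ _ _ _ 0 0) => //; first by rewrite invr_ge0 ltW.
exists 1%N => // n n0 /=; rewrite addn0 fb// mulKf//.
exact: lt0r_neq0.
Qed.

Let cyc x y : I x \/ I y -> N (x * y) <= K ^+ 2 * N (y * x).
Proof. exact: qn_cyclic iI qN x y. Qed.

(** Half of the factors [c] is carried around the product, so that each of [x] and
    [y] receives its own power of [c]. *)
Let localize_split_mul i j x y : (0 < i)%N -> (0 < j)%N ->
  N (c ^+ (i + j) * (x * y)) <= K ^+ 5 * N (c ^+ i * x) * N (c ^+ j * y).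
Proof.
move=> i0 j0; rewrite addnC exprD -mulrA.
apply: le_trans (cyc _) _; first by left; exact: Icn.
have -> : K ^+ 5 * N (c ^+ i * x) * N (c ^+ j * y) =
  K ^+ 2 * (K * N (c ^+ i * x) * (K ^+ 2 * N (c ^+ j * y))) by ring.
apply: ler_wpM2l; rewrite ?exprn_ge0// mulrA -mulrA.
apply: le_trans (qnM qN _ _) _; first exact: Icnz.
  by apply: (ideal_mull iI) => //; exact: Icn.
apply: ler_wpM2l; first by rewrite mulr_ge0.
by apply: cyc; right; exact: Icn.
Qed.

(** The square property is applied to [r z] with [r = c ^+ n]. In [r z r z] the
    inner [r] can be split off, after cyclic moves, at the cost of [N r]; what is
    left is [z r z], that is [r z^2] up to another cyclic move. *)
Let localize_split_sqr n z : (0 < n)%N ->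
  N (c ^+ n * z) ^+ 2 <= K ^+ 6 * N (c ^+ n) * N (c ^+ n * z ^+ 2).
Proof.
move=> n0; have Ix := Icn n0; set r := c ^+ n in Ix *.
apply: le_trans (qn_sqr qN _) _; first exact: (ideal_mulr iI).
have -> : K ^+ 6 * N r * N (r * z ^+ 2) =
  K * (K ^+ 2 * (K * N r * (K ^+ 2 * N (r * z ^+ 2)))) by ring.
apply: ler_wpM2l => //; rewrite expr2.
apply: le_trans (cyc (y := r * z) _) _; first by left; exact: (ideal_mulr iI).
apply: ler_wpM2l; rewrite ?exprn_ge0// -mulrA.
apply: le_trans (qnM qN Ix _) _.
  by apply: (ideal_mull iI) => //; exact: (ideal_mulr iI).
apply: ler_wpM2l; first by rewrite mulr_ge0.
by rewrite expr2 (mulrA r); apply: cyc; right; exact: (ideal_mulr iI).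
Qed.

(** Localization extends the quasi-norm from the ideal [I] to the whole algebra,
    since [c ^+ n * z] is in [I] for [0 < n]. *)
Lemma localize_quasi_norm : exists K', quasi_norm [set: U] K' e L.
Proof.
have [C C0 NC] := rateN.
pose K' := K ^+ 5 + K ^+ 6 * C; exists K'.
have K5 : 1 <= K ^+ 5 by rewrite exprn_ege1// (qn_ge1 qN).
have KC0 : 0 <= K ^+ 6 * C by rewrite mulr_ge0 ?exprn_ge0// ltW.
have LZ_le r z : L (r *: z) <= `|r| * L z.
  apply/ler_addgt0Pr => eps eps0.
  pose B := L z + eps / (`|r| + 1).
  have r1 : 0 < `|r| + 1 by rewrite ltr_wpDl.
  have ltB : L z < B by rewrite ltrDl divr_gt0.
  have [m mP] := localize_lt ltB.
  apply: (@le_trans _ _ (`|r| * B)); last first.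
    rewrite mulrDr lerD2l mulrCA ger_pMr// ler_pdivrMr// mul1r.
    by rewrite lerDl.
  apply: (@localize_le _ _ m) => n mn.
  have n0 : (0 < n)%N by lia.
  by rewrite -scalerAr (qnZ qN) -?mulrA ?ler_wpM2l ?mP//; exact: Icnz.
split=> //.
- by rewrite (le_trans K5)// lerDl.
- exact: localize_ge0.
- move=> r z _; apply/eqP; rewrite eq_le LZ_le /=.
  have [->|rn0] := eqVneq r 0; first by rewrite normr0 mul0r localize_ge0.
  rewrite mulrC -ler_pdivlMr ?normr_gt0// mulrC -normfV.
  by apply: le_trans (LZ_le _ _); rewrite scalerA mulVf// scale1r.
- move=> m g B gB; apply/ler_addgt0Pr => eps eps0.
  pose h := eps / m.+1%:R ^+ e.
  have m0 : 0 < m.+1%:R ^+ e :> R by rewrite exprn_gt0.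
  have h0 : 0 < h by rewrite divr_gt0.
  have : \forall n \near \oo,
      forall i : 'I_m.+1, N (c ^+ n * g i) <= (B + h) * rho ^+ n.
    apply: filter_forall => i; have [_ gi_le] := gB i (ltn_ord i).
    have [|k kP] := @localize_lt (g i) (B + h).
      by apply: le_lt_trans gi_le _; rewrite ltrDl.
    by exists k.+1 => // n /= kn; exact: kP.
  move=> [k _ kP]; apply: (@localize_le _ _ k) => n kn.
  rewrite mulr_sumr -[X in (_ * B + X)](mulfVK (lt0r_neq0 m0)) -/h [h * _]mulrC.
  rewrite -mulrDr -mulrA.
  apply: (@qn_sum _ _ _ _ _ _ qN m (fun i => c ^+ n * g i)) => i im.
  split; first by apply: Icnz; lia.
  by have := kP n (ltnW kn) (Ordinal (im : (i < m.+1)%N)).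
- move=> x y _ _; apply: le_mul_approx; rewrite ?localize_ge0 ?addr_ge0 ?exprn_ge0//.
  move=> a b /localize_lt[m mP] /localize_lt[k kP].
  apply: (@localize_le _ _ (m + k).+1.*2) => n mkn.
  pose i := n./2; pose j := (n - i)%N.
  have ij : n = (i + j)%N by rewrite /j /i; lia.
  have mi : (m < i)%N by rewrite /i; lia.
  have kj : (k < j)%N by rewrite /j /i; lia.
  rewrite ij; apply: le_trans (localize_split_mul _ _ _ _) _; [lia|lia|].
  have a0 : 0 <= a * rho ^+ i by apply: le_trans (mP i mi).
  have b0 : 0 <= b * rho ^+ j by apply: le_trans (kP j kj).
  have -> : K' * a * b * rho ^+ (i + j) = K' * (a * rho ^+ i * (b * rho ^+ j)).
    by rewrite exprD; ring.
  rewrite -mulrA; apply: ler_pM; rewrite ?mulr_ge0 ?exprn_ge0// ?lerDl//.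
  by apply: ler_pM; rewrite ?mP ?kP.
- move=> x _; rewrite mulrC -ler_pdivrMr; last first.
    by rewrite (lt_le_trans ltr01)// (le_trans K5)// lerDl.
  apply/ler_addgt0Pr => eps eps0; set B := L (x ^+ 2) + eps.
  have K'0 : 0 < K' by rewrite (lt_le_trans ltr01)// (le_trans K5)// lerDl.
  have [m mP] : exists m, forall n, (m < n)%N -> N (c ^+ n * x ^+ 2) <= B * rho ^+ n.
    by apply: localize_lt; rewrite ltrDl.
  have B0 : 0 <= B by rewrite addr_ge0 ?localize_ge0 ?ltW.
  rewrite ler_pdivrMr// -[leRHS]sqr_sqrtr; last by rewrite mulr_ge0// ltW.
  apply: lerXn2r; rewrite ?nnegrE ?localize_ge0 ?sqrtr_ge0//.
  apply: (@localize_le _ _ m) => n mn; have n0 : (0 < n)%N by lia.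
  rewrite -(@ler_pXn2r _ 2) ?nnegrE ?mulr_ge0 ?sqrtr_ge0 ?(ltW (rhoX_gt0 n))//.
  rewrite exprMn sqr_sqrtr; last by rewrite mulr_ge0// ltW.
  apply: le_trans (localize_split_sqr _ n0) _.
  have -> : B * K' * rho ^+ n ^+ 2 = K' * rho ^+ n * (B * rho ^+ n) by ring.
  apply: ler_pM; rewrite ?mulr_ge0 ?exprn_ge0 ?mP//.
  apply: (@le_trans _ _ (K ^+ 6 * C * rho ^+ n)).
    by rewrite -mulrA ler_wpM2l ?exprn_ge0// (NC _ n0).2.
  by rewrite ler_wpM2r ?lerDr ?(le_trans ler01 K5)// ltW.
Qed.

Lemma localize_expanding x r : 0 <= r ->
  expanding N x r -> expanding L x r.
Proof.
(* one factor K^2 for each of the two cyclic moves of c ^+ m past x ^+ n *)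
move=> r0 [eps eps0 Nx]; exists (eps / K ^+ 4).
  by rewrite divr_gt0 ?exprn_gt0.
move=> n y.
have k0 : 0 <= eps / K ^+ 4 * r ^+ n.
  by rewrite mulr_ge0 ?exprn_ge0// divr_ge0 ?exprn_ge0// ltW.
apply: (@limsup_leZ _ _ _ _ 0 0) => //.
exists 1%N => // m /= m0; rewrite addn0 mulrA ler_pM2r ?invr_gt0//.
have -> : eps / K ^+ 4 * r ^+ n * N (c ^+ m * y) =
    K ^- 2 * (eps * r ^+ n * (K ^- 2 * N (c ^+ m * y))).
  by field; rewrite lt0r_neq0.
have K2 : 0 < K ^+ 2 by rewrite exprn_gt0.
rewrite mulrC ler_pdivrMr//.
apply: (@le_trans _ _ (N (x ^+ n * (y * c ^+ m)))); last first.
  by rewrite mulrA [leRHS]mulrC; apply: cyc; right; exact: Icn.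
apply: le_trans (Nx _ _); rewrite ler_wpM2l ?mulr_ge0 ?exprn_ge0 ?(ltW eps0)//.
by rewrite mulrC ler_pdivrMr// mulrC; apply: cyc; left; exact: Icn.
Qed.

Lemma localize_expanding_self : expanding L c rho.
Proof.
exists 1 => // n y; rewrite mul1r.
elim: n => [|n IHn]; first by rewrite !expr0 !mul1r.
by rewrite !exprS -!mulrA localize_shift ler_wpM2l// ltW.
Qed.

End Localization.

(** * The parallelogram identity for commuting elements *)

Section Parallelogram.
Variables (R : realType) (U : algType R) (v w : U).
Hypothesis vw : GRing.comm v w.
Implicit Types P Q : {poly R}.

(** Homogeneous polynomials of degree [m] in two commuting elements are encoded by
    their dehomogenization [Q], of size at most [m.+1]. Multiplication by [v] and
    by [w] then becomes multiplication of [Q] by ['X] and by [1]. *)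
Definition eval_homog m Q : U :=
  \sum_(j < m.+1) Q`_j *: (v ^+ j * w ^+ (m - j)).

Definition sum_sqr_coef m Q : R := \sum_(j < m.+1) Q`_j ^+ 2.

Lemma eval_homogD m a b P Q :
  eval_homog m (a *: P + b *: Q) = a *: eval_homog m P + b *: eval_homog m Q.
Proof.
rewrite /eval_homog !scaler_sumr -big_split /=; apply: eq_bigr => j _.
by rewrite !scalerA -scalerDl coefD !coefZ.
Qed.

Lemma eval_homog_mulX m Q : eval_homog m.+1 (Q * 'X) = v * eval_homog m Q.
Proof.
rewrite /eval_homog big_ord_recl coefMX /= scale0r add0r mulr_sumr.
apply: eq_bigr => j _; rewrite coefMX /= /bump /= add1n subSS.
by rewrite -scalerAr mulrA -exprS.
Qed.

Lemma eval_homog_widen m Q : (size Q <= m.+1)%N ->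
  eval_homog m.+1 Q = w * eval_homog m Q.
Proof.
move=> sQ; rewrite /eval_homog big_ord_recr /= (nth_default _ sQ) scale0r addr0.
rewrite mulr_sumr; apply: eq_bigr => j _; rewrite -scalerAr; congr (_ *: _).
rewrite mulrA (commrX j (commr_sym vw)) -mulrA -exprS -subSn//.
by rewrite -ltnS.
Qed.

Lemma sum_sqr_coef_mulX m Q : sum_sqr_coef m.+1 (Q * 'X) = sum_sqr_coef m Q.
Proof.
rewrite /sum_sqr_coef big_ord_recl coefMX /= expr0n add0r.
by apply: eq_bigr => j _; rewrite coefMX.
Qed.

Lemma sum_sqr_coef_widen m Q : (size Q <= m.+1)%N ->
  sum_sqr_coef m.+1 Q = sum_sqr_coef m Q.
Proof.
move=> sQ.
by rewrite /sum_sqr_coef big_ord_recr /= (nth_default _ sQ) expr0n addr0.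
Qed.

Lemma sum_sqr_coef_gt0 m Q : (size Q <= m.+1)%N -> Q != 0 -> 0 < sum_sqr_coef m Q.
Proof.
move=> sQ Q0; have sQ0 : (0 < size Q)%N by rewrite size_poly_gt0.
have lt_s : ((size Q).-1 < m.+1)%N by rewrite prednK.
rewrite /sum_sqr_coef (bigD1 (Ordinal lt_s))//= ltr_pwDl//.
  by rewrite -lead_coefE exprn_even_gt0 //= lead_coef_eq0.
by apply: sumr_ge0 => j _; rewrite sqr_ge0.
Qed.

Lemma sqr_coef_le m Q j : (j <= m)%N -> Q`_j ^+ 2 <= sum_sqr_coef m Q.
Proof.
move=> jm; rewrite /sum_sqr_coef (bigD1 (Ordinal (jm : (j < m.+1)%N)))//=.
by rewrite lerDl sumr_ge0// => i _; rewrite sqr_ge0.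
Qed.

(** In a Hilbert space, [t |x|^2 + (1-t) |y|^2] is
    [|t x + (1-t) y|^2 + t (1-t) |x - y|^2]; here [x] and [y] are the coefficient
    vectors of [Q * 'X] and [Q], which have the same length. *)
Lemma sum_sqr_coef_parallelogram m Q (t : R) : (size Q <= m.+1)%N ->
  sum_sqr_coef m.+1 (t *: (Q * 'X) + (1 - t) *: Q) +
  t * (1 - t) * sum_sqr_coef m.+1 (1 *: (Q * 'X) + (-1) *: Q) = sum_sqr_coef m Q.
Proof.
move=> sQ; transitivity (t * sum_sqr_coef m.+1 (Q * 'X) +
    (1 - t) * sum_sqr_coef m.+1 Q); last first.
  by rewrite sum_sqr_coef_mulX sum_sqr_coef_widen//; ring.
rewrite /sum_sqr_coef !mulr_sumr -!big_split /=; apply: eq_bigr => j _.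
by rewrite !coefD !coefZ; ring.
Qed.

Section Greedy.
Variables (t rho delta : R).
Hypotheses (t0 : 0 <= t) (t1 : t <= 1) (rho0 : 0 <= rho) (delta0 : 0 <= delta).
Let S := rho ^+ 2 + t * (1 - t) * delta ^+ 2.
Let c := t *: v + (1 - t) *: w.

(** By the parallelogram identity, if multiplication by [t v + (1-t) w] leaves more
    than the proportion [rho^2 / S] of the sum of squares, then multiplication by
    [v - w] leaves at most [delta^2 / S]. So one of the two factors can be appended
    at each step. *)
Lemma greedy_polynomial m : exists n k Q, [/\ (n + k = m)%N,
  (size Q <= m.+1)%N, Q != 0, eval_homog m Q = c ^+ n * (v - w) ^+ k &
  sum_sqr_coef m Q * S ^+ m <= rho ^+ (2 * n) * delta ^+ (2 * k)].
Proof.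
have S0 : 0 <= S by rewrite addr_ge0 ?sqr_ge0// !mulr_ge0 ?subr_ge0 ?sqr_ge0.
have comm_c : GRing.comm (v - w) c.
  apply: commrD; apply: commr_sym; rewrite /GRing.comm -scalerAl -scalerAr;
    congr (_ *: _); rewrite mulrBl mulrBr; congr (_ - _).
  - exact: vw.
  - exact: commr_sym.
elim: m => [|m [n [k [Q [nk sQ Q0 evQ le_Q]]]]].
  exists 0%N, 0%N, 1; rewrite /eval_homog /sum_sqr_coef !big_ord1 coef1 /=.
  rewrite size_poly1 oner_neq0 scale1r !expr0 !mulr1 expr1n.
  by split.
have par := sum_sqr_coef_parallelogram t sQ.
pose Q1 : {poly R} := t *: (Q * 'X) + (1 - t) *: Q.
pose Q2 : {poly R} := 1 *: (Q * 'X) + (-1) *: Q.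
rewrite -/Q1 -/Q2 in par.
have B0 : 0 < sum_sqr_coef m Q by exact: sum_sqr_coef_gt0.
have sz (a b : R) : (size (a *: (Q * 'X) + b *: Q)%R <= m.+2)%N.
  rewrite (leq_trans (size_polyD _ _))// geq_max.
  rewrite !(leq_trans (size_scale_leq _ _))//; first exact: ltnW.
  by rewrite size_mulX.
have nz (a b : R) : a + b != 0 \/ a != 0 -> a *: (Q * 'X) + b *: Q != 0.
  move=> ab; have -> : a *: (Q * 'X) + b *: Q = Q * (a%:P * 'X + b%:P).
    by rewrite -!mul_polyC; ring.
  rewrite mulf_neq0//; apply: contraTneq isT => /polyP ab0.
  have := ab0 0%N; have := ab0 1%N.
  rewrite !(coefD, coefMX, coefC) /= addr0 add0r => a0 b0.
  by move: ab; rewrite a0 b0 addr0 eqxx; case.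
have ev (a b : R) : eval_homog m.+1 (a *: (Q * 'X) + b *: Q) =
    (a *: v + b *: w) * (c ^+ n * (v - w) ^+ k).
  by rewrite eval_homogD eval_homog_mulX eval_homog_widen// -evQ mulrDl !scalerAl.
have le_step q b : 0 <= b -> sum_sqr_coef m.+1 q * S <= b * sum_sqr_coef m Q ->
    sum_sqr_coef m.+1 q * S ^+ m.+1 <=
      b * (rho ^+ (2 * n) * delta ^+ (2 * k)).
  move=> b0 le_b; rewrite exprS mulrA.
  apply: le_trans (ler_wpM2r (exprn_ge0 m S0) le_b) _.
  by rewrite -mulrA ler_wpM2l.
have [le1|lt1] := leP (sum_sqr_coef m.+1 Q1 * S) (rho ^+ 2 * sum_sqr_coef m Q).
  exists n.+1, k, Q1; split=> //.
  - by rewrite addSn nk.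
  - exact: sz.
  - by apply: (nz t (1 - t)); left; rewrite addrC subrK oner_eq0.
  - by rewrite /Q1 ev -/c mulrA -exprS.
  - by apply: le_trans (le_step _ _ _ le1) _; rewrite ?sqr_ge0// mulnS exprD mulrA.
exists n, k.+1, Q2; split=> //.
- by rewrite addnS nk.
- exact: sz.
- by apply: (nz 1 (- 1)); right; rewrite oner_eq0.
- by rewrite /Q2 ev scale1r scaleN1r mulrA (commrX n comm_c) -mulrA -exprS.
have le2 : sum_sqr_coef m.+1 Q2 * S <= delta ^+ 2 * sum_sqr_coef m Q.
  rewrite leNgt; apply/negP => lt2.
  have k0 : 0 <= t * (1 - t) by rewrite mulr_ge0 ?subr_ge0.
  move: lt1 (ler_wpM2l k0 (ltW lt2)); rewrite -par /S; lra.
by apply: le_trans (le_step _ _ _ le2) _; rewrite ?sqr_ge0// mulnS exprD mulrCA.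
Qed.

Variables (K C1 K0 : R) (e : nat) (N : U -> R).
Hypotheses (qN : quasi_norm [set: U] K e N).
Hypotheses (N_c : forall y, N (c * y) = rho * N y) (C1_gt0 : 0 < C1).
Hypotheses (N_vw : forall k, delta ^+ k <= C1 * N ((v - w) ^+ k)).
Hypotheses (K0_gt0 : 0 < K0) (N_le : forall i j, N (v ^+ i * w ^+ j) <= K0).

(** The element produced by [greedy_polynomial] has quasi-norm at least
    [rho ^+ n * delta ^+ k], up to a constant. It is at most the largest coefficient
    times a factor polynomial in [m], and the coefficients are smaller than
    [rho ^+ n * delta ^+ k] by the factor [Num.sqrt S ^+ m]. *)
Lemma parallelogram_bound : rho ^+ 2 + t * (1 - t) * delta ^+ 2 <= 1.
Proof.
have S0 : 0 <= S by rewrite addr_ge0 ?sqr_ge0// !mulr_ge0 ?subr_ge0 ?sqr_ge0.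
rewrite -/S.
apply: (@le_of_exp_le _ _ _ ((C1 * K0) ^+ 2) (2 * e)) => // m.
exists m => //; rewrite expr1n mulr1.
have [n [k [Q [nk sQ Q0 evQ le_Q]]]] := greedy_polynomial m.
have s0 := sum_sqr_coef_gt0 sQ Q0; set s := sum_sqr_coef m Q in le_Q s0.
have N_cX y : N (c ^+ n * y) = rho ^+ n * N y.
  elim: (n) => [|i IHi]; first by rewrite !expr0 !mul1r.
  by rewrite !exprS -!mulrA N_c IHi.
have coef_le j : (j <= m)%N -> `|Q`_j| <= Num.sqrt s.
  move=> jm; rewrite -sqrtr_sqr ler_sqrt ?sqr_coef_le//.
  exact: ltW.
have N_ev : N (eval_homog m Q) <= m.+1%:R ^+ e * (Num.sqrt s * K0).
  apply: (@qn_sum _ _ _ _ _ _ qN m (fun j => Q`_j *: (v ^+ j * w ^+ (m - j)))).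
  move=> j jm; split=> //; rewrite (qnZ qN)//.
  by apply: ler_pM => //; [exact: (qn_ge0 qN) | exact: coef_le].
have le_s : rho ^+ n * delta ^+ k <= C1 * (m.+1%:R ^+ e * (Num.sqrt s * K0)).
  apply: (@le_trans _ _ (C1 * N (eval_homog m Q))); last by rewrite ler_wpM2l// ltW.
  by rewrite evQ N_cX mulrCA ler_wpM2l ?exprn_ge0.
rewrite -(ler_pM2l s0); apply: le_trans le_Q _.
have -> : rho ^+ (2 * n) * delta ^+ (2 * k) = (rho ^+ n * delta ^+ k) ^+ 2.
  by rewrite exprMn -!exprM ![(_ * 2)%N]mulnC.
have -> : s * ((C1 * K0) ^+ 2 * m.+1%:R ^+ (2 * e)) =
    (C1 * (m.+1%:R ^+ e * (Num.sqrt s * K0))) ^+ 2.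
  by rewrite -{1}(sqr_sqrtr (ltW s0)) mulnC exprM; ring.
by apply: lerXn2r; rewrite ?nnegrE ?mulr_ge0 ?exprn_ge0 ?sqrtr_ge0// ltW.
Qed.
End Greedy.
End Parallelogram.

(** * Making an element quadratic *)

Section QuadraticLocalization.
Variables (R : realType) (U : algType R) (e : nat).
Implicit Types (K C r s t rho alpha : R) (N L : U -> R) (x y z : U).

Definition full_quasi_norm N :=
  (exists K, quasi_norm [set: U] K e N) /\ 0 < N 1.

(** The two things that pass from a quasi-norm to its localizations: upper bounds
    up to a constant, in particular membership in the kernel, and lower bounds on
    powers. *)
Definition subordinate L N :=
  (exists2 C, 0 <= C & forall z, L z <= C * N z) /\
  (forall x r, 0 <= r -> expanding N x r -> expanding L x r).

Lemma subordinate_refl N : subordinate N N.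
Proof. by split=> //; exists 1 => // z; rewrite mul1r. Qed.

Lemma subordinate_trans N L' L :
  subordinate L L' -> subordinate L' N -> subordinate L N.
Proof.
move=> [[C C0 le] ex] [[C' C'0 le'] ex']; split; last first.
  by move=> x r r0 /(ex' _ _ r0); exact: ex.
exists (C * C'); first exact: mulr_ge0.
by move=> z; apply: le_trans (le z) _; rewrite -mulrA ler_wpM2l.
Qed.

Section Kernel.
Variable N : U -> R.
Hypothesis fN : full_quasi_norm N.

Lemma full_ge0 x : 0 <= N x.
Proof. by case: fN => -[K qN] _; exact: qn_ge0 qN x. Qed.

Lemma fullZ r x : N (r *: x) = `|r| * N x.
Proof. by case: fN => -[K qN] _; by rewrite (qnZ qN). Qed.

Lemma ker_scale r x : N x = 0 -> N (r *: x) = 0.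
Proof. by rewrite fullZ => ->; rewrite mulr0. Qed.

Lemma ker_add x y : N x = 0 -> N y = 0 -> N (x + y) = 0.
Proof.
case: fN => -[K qN] _ x0 y0; apply/eqP; rewrite eq_le (qn_ge0 qN) andbT.
have := qnD qN (I : [set: U] x) (I : [set: U] y) (B := 0).
by rewrite x0 y0 mulr0; apply.
Qed.

Lemma ker_mull x y : N y = 0 -> N (x * y) = 0.
Proof.
case: fN => -[K qN] _ y0; apply/eqP; rewrite eq_le (qn_ge0 qN) andbT.
by apply: le_trans (qnM qN _ _) _; rewrite // y0 mulr0.
Qed.

Lemma ker_mulr x y : N x = 0 -> N (x * y) = 0.
Proof.
case: fN => -[K qN] _ x0; apply/eqP; rewrite eq_le (qn_ge0 qN) andbT.
by apply: le_trans (qnM qN _ _) _; rewrite // x0 mulr0 mul0r.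
Qed.

Lemma ker_scalar r : N (r *: 1) = 0 -> r = 0.
Proof.
case: fN => _ N1; rewrite fullZ => /eqP.
by rewrite mulf_eq0 (gt_eqF N1) orbF normr_eq0 => /eqP.
Qed.

Lemma full_growth_rate x : exists2 rho, 0 <= rho & growth_rate N x rho.
Proof. by case: fN => -[K qN] _; exact: (growth_rate_exists (ideal_setT U) qN). Qed.

Lemma growth_rate0 rho x : growth_rate N x rho -> exists2 C, 0 < C &
  forall n, rho ^+ n <= C * N (x ^+ n) /\ N (x ^+ n) <= C * rho ^+ n.
Proof.
case: fN => _ N1 [C C0 NC]; exists (C + (N 1)^-1 + N 1).
  by rewrite !addr_gt0 ?invr_gt0.
have le_C : C <= C + (N 1)^-1 + N 1.
  by rewrite -addrA lerDl addr_ge0 ?invr_ge0 ?full_ge0.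
case=> [|n]; last first.
  have [//|up lo] := NC n.+1; split.
    by apply: le_trans up _; rewrite ler_wpM2r ?full_ge0.
  have [rho0|rho0] := leP 0 (rho ^+ n.+1).
    by apply: le_trans lo _; rewrite ler_wpM2r.
  by have := full_ge0 (x ^+ n.+1); have := pmulr_rlt0 (rho ^+ n.+1) C0; lra.
rewrite !expr0 mulr1; split; last by rewrite lerDr addr_ge0 ?invr_ge0 ?ltW.
rewrite -ler_pdivrMr// mul1r -addrA addrCA lerDl.
by rewrite addr_ge0// ltW.
Qed.

Lemma localization_exists x : N x != 0 -> exists rho L,
  [/\ 0 < rho, growth_rate N x rho, full_quasi_norm L, subordinate L N &
      (forall z, L (x * z) = rho * L z) /\
      (forall y r, 0 < r -> GRing.comm y x -> (forall z, N (y * z) = r * N z) ->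
        forall z, L (y * z) = r * L z)].
Proof.
move=> Nx0; have [rho rho0 rateN] := full_growth_rate x.
have rho_gt0 : 0 < rho.
  rewrite lt_neqAle rho0 andbT; apply: contraNneq Nx0 => rho_eq0.
  have [C C0 NC] := rateN; have [_] := NC 1%N isT.
  by rewrite -rho_eq0 !expr1 mulr0 eq_le full_ge0 andbT.
have [[K qN] N1] := fN; have iT := ideal_setT U.
exists rho, (localize N x rho); split=> //.
- split; last exact: (localize1_gt0 iT qN).
  exact: (localize_quasi_norm iT qN).
- split; last by move=> y r; exact: (localize_expanding iT qN).
  have [C C0 LC] := localize_le_ideal iT qN (I : [set: U] x) rho_gt0 rateN.
  by exists C => [|z]; [exact: ltW | exact: LC].
- split; first exact: (localize_shift iT qN).
  by move=> y r r0 yx Ny; apply: (localize_comm iT qN) => //.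
Qed.

End Kernel.

Lemma subordinate_ker L N z : full_quasi_norm L -> subordinate L N ->
  N z = 0 -> L z = 0.
Proof.
move=> fL [[C _ LC] _] z0; apply/eqP; rewrite eq_le (full_ge0 fL) andbT.
by rewrite (le_trans (LC z))// z0 mulr0.
Qed.

(** In the function picture [u] has modulus 1 and [1 + u] has modulus [g], so the real
    part of [u] is [(g^2 - 2) / 2] everywhere. The first use of
    [parallelogram_bound], with [1] and [u], gives [g^2 + d^2 <= 4] for the growth
    rate [d] of [1 - u]. The second one starts from the elements [v] and [w], which
    are [(1 + u)^2 / g^2] and [- (1 - u)^2 / (4 - g^2)]; they have bounded powers by
    the first, and a convex combination of them is [u], an isometry. Hence [v - w]
    has growth rate 0, and it is a multiple of the required polynomial. *)
Lemma isometries_quadratic N u g : full_quasi_norm N -> 0 < g ->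
  (forall z, N (u * z) = N z) -> (forall z, N ((1 + u) * z) = g * N z) ->
  N (u ^+ 2 + (2 - g ^+ 2) *: u + 1) = 0.
Proof.
move=> fN g0 Nu Ng; have [[K qN] N1] := fN.
have [d d0 /(growth_rate0 fN)[C C0 NC]] := full_growth_rate fN (1 - u).
have comm1u : GRing.comm 1 u by exact/commr_sym/commr1.
have NuX j : N (u ^+ j) = N 1.
  by elim: j => [|j IHj]; rewrite ?expr0// exprS Nu.
have gd : g ^+ 2 + d ^+ 2 <= 4.
  have := @parallelogram_bound R U 1 u comm1u (2^-1) (g / 2) d _ _ _ _
    K C (N 1) e N qN _ C0.
  have -> : (g / 2) ^+ 2 + 2^-1 * (1 - 2^-1) * d ^+ 2 = (g ^+ 2 + d ^+ 2) / 4 by field.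
  rewrite ler_pdivrMr// mul1r; apply=> //.
  - lra.
  - by rewrite divr_ge0// ltW.
  - move=> y; have -> : (1 - 2^-1 : R) = 2^-1 by field.
    by rewrite -scalerDr -scalerAl (fullZ fN) Ng ger0_norm// mulrA [_ * g]mulrC.
  - by move=> k; exact: (NC k).1.
  - by move=> i j; rewrite expr1n mul1r NuX.
(* the spectrum of u is reduced to 1, and w would be undefined *)
have [g4|gn4] := eqVneq (g ^+ 2) 4.
  have d_eq0 : d = 0 by apply/eqP; rewrite -sqrf_eq0 eq_le sqr_ge0 andbT; lra.
  have N1u : N (1 - u) = 0.
    apply/eqP; rewrite eq_le (full_ge0 fN) andbT.
    by have [_] := NC 1%N; rewrite d_eq0 !expr1 mulr0.
  have -> : u ^+ 2 + (2 - g ^+ 2) *: u + 1 = (1 - u) * (1 - u).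
    by rewrite g4; alg_ring.
  exact: ker_mull.
pose h := 4 - g ^+ 2.
have h0 : 0 < h by rewrite subr_gt0 lt_neqAle gn4 /=; have := sqr_ge0 d; lra.
have g20 : 0 < g ^+ 2 by rewrite exprn_gt0.
pose v := (g ^+ 2)^-1 *: (1 + u) ^+ 2; pose w := - h^-1 *: (1 - u) ^+ 2.
have vw : GRing.comm v w.
  by rewrite /GRing.comm /v /w; move: (- h^-1) (_^-1) => b a; alg_ring.
have cE : (g ^+ 2 / 4) *: v + (1 - g ^+ 2 / 4) *: w = u.
  rewrite /v /w !scalerA.
  have -> : g ^+ 2 / 4 / g ^+ 2 = 4^-1 by field; rewrite lt0r_neq0.
  have -> : (1 - g ^+ 2 / 4) * - h^-1 = - 4^-1.
    by rewrite /h; field; rewrite lt0r_neq0.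
  rewrite scaleNr -scalerBr (_ : _ - _ = 4%:R *: u); last by alg_ring.
  by rewrite scalerA mulVf ?scale1r// pnatr_eq0.
have Nv z : N (v * z) = N z.
  rewrite -scalerAl (fullZ fN) [(1 + u) ^+ 2]expr2 -mulrA !Ng.
  by rewrite ger0_norm ?invr_ge0 ?(ltW g20)//; field; rewrite lt0r_neq0.
have Nw j : N (w ^+ j) <= C.
  rewrite exprZn (fullZ fN) -exprM normrX normrN normfV (gtr0_norm h0).
  have [_ le_d] := NC (2 * j)%N; rewrite exprVn mulrC ler_pdivrMr ?exprn_gt0//.
  apply: le_trans le_d _; rewrite ler_wpM2l ?(ltW C0)// exprM.
  by apply: lerXn2r; rewrite ?nnegrE ?sqr_ge0 ?(ltW h0)// /h; lra.
have [r r0 /(growth_rate0 fN)[C' C'0 NC']] := full_growth_rate fN (v - w).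
have : 1 ^+ 2 + g ^+ 2 / 4 * (1 - g ^+ 2 / 4) * r ^+ 2 <= 1.
  apply: (@parallelogram_bound R U v w vw _ 1 r _ _ _ _ K C' C e N qN _ C'0) => //.
  - by rewrite divr_ge0// ltW.
  - rewrite ler_pdivrMr// mul1r; move: h0; rewrite /h; lra.
  - by move=> y; rewrite cE Nu mul1r.
  - by move=> k; exact: (NC' k).1.
  - move=> i j; elim: i => [|i IHi]; first by rewrite expr0 mul1r.
    by rewrite exprS -mulrA Nv.
rewrite expr1n gerDl.
have th : 0 < g ^+ 2 / 4 * (1 - g ^+ 2 / 4).
  rewrite mulr_gt0 ?divr_gt0// subr_gt0 ltr_pdivrMr// mul1r.
  by move: h0; rewrite /h; lra.
rewrite pmulr_rle0// => r_le0.
have r_eq0 : r = 0 by apply/eqP; rewrite -sqrf_eq0 eq_le r_le0 sqr_ge0.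
have Nvw : N (v - w) = 0.
  apply/eqP; rewrite eq_le (full_ge0 fN) andbT.
  by have [_] := NC' 1%N; rewrite r_eq0 !expr1 mulr0.
have -> : u ^+ 2 + (2 - g ^+ 2) *: u + 1 = (g ^+ 2 * h / 4) *: (v - w).
  rewrite /v /w scalerBr !scalerA.
  have -> : g ^+ 2 * h / 4 / g ^+ 2 = 4^-1 * h by field; rewrite lt0r_neq0.
  have -> : g ^+ 2 * h / 4 * - h^-1 = 4^-1 * - g ^+ 2 by field; rewrite lt0r_neq0.
  rewrite -!scalerA -scalerBr; apply: (scalerI (_ : 4 != 0 :> R)).
    by rewrite pnatr_eq0.
  rewrite [RHS]scalerA mulfV ?pnatr_eq0// scale1r /h; alg_ring.
exact: ker_scale.
Qed.

Lemma quadratic_localization N a : full_quasi_norm N ->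
  exists L s alpha, [/\ full_quasi_norm L, subordinate L N, 0 <= alpha,
    growth_rate N a alpha & L (a ^+ 2 - s *: a + alpha ^+ 2 *: 1) = 0].
Proof.
move=> fN; have [Na0|Na0] := eqVneq (N a) 0.
  exists N, 0, 0; split=> //; first exact: subordinate_refl.
    exists 1 => // n n0; rewrite expr0n eqn0Ngt n0 /= mulr0 mul1r full_ge0//.
    by case: n n0 => // n _; rewrite exprSr ker_mull.
  by rewrite expr0n /= !scale0r subr0 addr0 expr2 ker_mull.
have [alpha [M [al0 rate_a fM subM [Ma comM]]]] := localization_exists fN Na0.
pose u := alpha^-1 *: a.
have aE : a = alpha *: u by rewrite scalerA mulfV ?scale1r// lt0r_neq0.
have Mu z : M (u * z) = M z.
  rewrite -scalerAl (fullZ fM) Ma ger0_norm ?invr_ge0 ?(ltW al0)// mulKf//.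
  exact: lt0r_neq0.
(* the case u = - 1, in which there is nothing to localize at *)
have [Mu0|Mu0] := eqVneq (M (1 + u)) 0.
  exists M, (- (2 * alpha)), alpha; split=> //; first exact: ltW.
  rewrite (_ : _ + _ = alpha ^+ 2 *: (1 + u) ^+ 2).
    by rewrite ker_scale// expr2 ker_mull.
  by rewrite aE; move: (u) => z; alg_ring.
have [g [L [g0 _ fL subL [Lg comL]]]] := localization_exists fM Mu0.
have Lu z : L (u * z) = L z.
  rewrite -[RHS]mul1r; apply: comL => //; first exact/commrD/commr_refl/commr1.
  by move=> y; rewrite mul1r.
exists L, (alpha * (g ^+ 2 - 2)), alpha; split=> //.
- exact: subordinate_trans subL subM.
- exact: ltW.
rewrite (_ : _ + _ = alpha ^+ 2 *: (u ^+ 2 + (2 - g ^+ 2) *: u + 1)).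
  by rewrite ker_scale// isometries_quadratic.
by rewrite aE; move: (u) => z; alg_ring.
Qed.

End QuadraticLocalization.

(** * Two quadratic elements *)

Section PairRelations.
Variables (R : realType) (U : algType R) (e : nat) (L : U -> R).
Hypothesis fL : full_quasi_norm e L.
Implicit Types (a b x y z : U) (r s t : R).

Let D a b := a * b - b * a.
Let Q a s t := a ^+ 2 - s *: a + t *: 1.

Lemma ker0 : L 0 = 0.
Proof. by rewrite -(scale0r 1) (fullZ fL) normr0 mul0r. Qed.

Lemma ker_opp x : L x = 0 -> L (- x) = 0.
Proof. by move=> x0; rewrite -scaleN1r; exact: (ker_scale fL). Qed.

Lemma ker_sub x y : L x = 0 -> L y = 0 -> L (x - y) = 0.
Proof. by move=> x0 y0; apply: (ker_add fL) => //; exact: ker_opp. Qed.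

Lemma le_congr x y : L (x - y) = 0 -> L x <= 2 ^+ e * L y.
Proof.
case: fL => -[K qL] _ xy0; rewrite -(subrK y x).
apply: (qnD qL) => //; rewrite ?xy0; exact: (full_ge0 fL).
Qed.

Lemma ker_sum n (f : nat -> U) : (forall i, (i < n)%N -> L (f i) = 0) ->
  L (\sum_(i < n) f i) = 0.
Proof.
elim: n => [|n IHn] f0.
  by rewrite big_ord0 ker0.
rewrite big_ord_recr /=; apply: (ker_add fL); last exact: f0.
by apply: IHn => i ni; apply: f0; rewrite ltnS ltnW.
Qed.

Section Commuting.
Variables a b : U.
Hypothesis ab0 : L (D a b) = 0.

Lemma ker_commX n : L (b * a ^+ n - a ^+ n * b) = 0.
Proof.
elim: n => [|n IHn]; first by rewrite expr0 mul1r mulr1 subrr ker0.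
have -> : b * a ^+ n.+1 - a ^+ n.+1 * b =
    a * (b * a ^+ n - a ^+ n * b) - D a b * a ^+ n.
  by rewrite exprS /D; move: (a ^+ n) => c; alg_ring.
by apply: ker_sub; [exact: (ker_mull fL) | exact: (ker_mulr fL)].
Qed.

Lemma ker_exprM n : L ((a * b) ^+ n - a ^+ n * b ^+ n) = 0.
Proof.
elim: n => [|n IHn]; first by rewrite !expr0 mulr1 subrr ker0.
have -> : (a * b) ^+ n.+1 - a ^+ n.+1 * b ^+ n.+1 =
    a * b * ((a * b) ^+ n - a ^+ n * b ^+ n) +
    a * (b * a ^+ n - a ^+ n * b) * b ^+ n.
  by rewrite !exprS; move: ((a * b) ^+ n) (a ^+ n) (b ^+ n) => c d f; alg_ring.
apply: (ker_add fL); first exact: (ker_mull fL).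
by apply: (ker_mulr fL); apply: (ker_mull fL); exact: ker_commX.
Qed.

Lemma ker_binomial n : L ((a + b) ^+ n - eval_homog a b n (('X + 1) ^+ n)) = 0.
Proof.
elim: n => [|n IHn].
  by rewrite /eval_homog !expr0 big_ord1 coef1 /= scale1r mulr1 subrr ker0.
set P : {poly R} := ('X + 1) ^+ n in IHn *.
have sP : (size P <= n.+1)%N.
  by rewrite /P (leq_trans (size_poly_exp_leq _ _))// -[1]/(1%:P) size_XaddC mul1n.
have -> : (a + b) ^+ n.+1 - eval_homog a b n.+1 (('X + 1) ^+ n.+1) =
    (a + b) * ((a + b) ^+ n - eval_homog a b n P) +
    (b * eval_homog a b n P - eval_homog a b n.+1 P).
  rewrite !exprS -/P (_ : ('X + 1) * P = 1 *: (P * 'X) + 1 *: P); last first.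
    by rewrite !scale1r; ring.
  rewrite eval_homogD !scale1r eval_homog_mulX.
  move: ((a + b) ^+ n) (eval_homog a b n P) (eval_homog a b n.+1 P) => c d f.
  by alg_ring.
apply: (ker_add fL); first exact: (ker_mull fL).
rewrite /eval_homog [X in _ - X]big_ord_recr /= (nth_default _ sP) scale0r addr0.
rewrite mulr_sumr -sumrB.
apply: (ker_sum (f := fun i => b * (P`_i *: (a ^+ i * b ^+ (n - i))) -
  P`_i *: (a ^+ i * b ^+ (n.+1 - i)))).
move=> i ni; rewrite subSn// exprS.
have -> : b * (P`_i *: (a ^+ i * b ^+ (n - i))) -
    P`_i *: (a ^+ i * (b * b ^+ (n - i))) =
    P`_i *: ((b * a ^+ i - a ^+ i * b) * b ^+ (n - i)).
  by move: (a ^+ i) (b ^+ (n - i)) (P`_i) => c d f; alg_ring.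
by apply: (ker_scale fL); apply: (ker_mulr fL); exact: ker_commX.
Qed.

End Commuting.

Section NonCommuting.
Variables (a b : U) (s t s' t' s'' t'' : R).
Hypotheses (D0 : L (D a b) != 0) (Qa : L (Q a s t) = 0) (Qb : L (Q b s' t') = 0)
  (Qab : L (Q (a + b) s'' t'') = 0).

Lemma scalar_comm0 x r r' y : L (x * y - y * x) != 0 ->
  L (r *: x + r' *: 1) = 0 -> r = 0 /\ r' = 0.
Proof.
move=> xy0 rx; have r0 : r = 0.
  have : L (r *: (x * y - y * x)) = 0.
    have -> : r *: (x * y - y * x) =
        (r *: x + r' *: 1) * y - y * (r *: x + r' *: 1) by alg_ring.
    by apply: ker_sub; [exact: (ker_mulr fL) | exact: (ker_mull fL)].
  by rewrite (fullZ fL) => /eqP; rewrite mulf_eq0 (negPf xy0) orbF normr_eq0 => /eqP.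
by split=> //; move: rx; rewrite r0 scale0r add0r => /(ker_scalar fL).
Qed.

Let nu := t + t' - t''.

(** The three quadratic equations give [a b + b a] as a combination of [a], [b] and
    [1] with coefficients [s'' - s] and [s'' - s']. Taking commutators with [a] and
    comparing with [a ^+ 2 * b - b * a ^+ 2] identifies [s'' - s'] with the trace [s] of [a],
    because the commutator of [a] and [b] is not in the kernel. *)
Lemma quaternion_anticommutator : L (a * b + b * a - s' *: a - s *: b - nu *: 1) = 0.
Proof.
pose E := a * b + b * a - (s'' - s) *: a - (s'' - s') *: b - nu *: 1.
have E0 : L E = 0.
  have -> : E = Q (a + b) s'' t'' - Q a s t - Q b s' t' by rewrite /E /Q /nu; alg_ring.
  by apply: ker_sub => //; exact: ker_sub.
have scale0 r : L (r *: D a b) = 0 -> r = 0.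
  by rewrite (fullZ fL) => /eqP; rewrite mulf_eq0 (negPf D0) orbF normr_eq0 => /eqP.
have k1 := ker_mull fL a E0; have k2 := ker_mulr fL a E0.
have k3 := ker_mull fL b Qa; have k4 := ker_mulr fL b Qa.
have k5 := ker_mull fL b E0; have k6 := ker_mulr fL b E0.
have k7 := ker_mull fL a Qb; have k8 := ker_mulr fL a Qb.
have e1 : s'' - s' - s = 0.
  apply: scale0.
  have -> : (s'' - s' - s) *: D a b =
      Q a s t * b - b * Q a s t - (a * E - E * a).
    by rewrite /D /Q /E; alg_ring.
  by do ! apply: ker_sub.
have e2 : s'' - s = s' by lra.
have e3 : s'' - s' = s by lra.
by move: E0; rewrite /E e2 e3.
Qed.

Let E := a * b + b * a - s' *: a - s *: b - nu *: 1.

(** The constant term is the multiplicativity of the quaternion norm. *)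
Lemma quaternion_product : L (Q (a * b) (s * s' + nu) (t * t')) = 0.
Proof.
have E0 := quaternion_anticommutator.
have -> : Q (a * b) (s * s' + nu) (t * t') =
    a * E * b - Q a s t * (b * b) + t *: Q b s' t' + s' *: (Q a s t * b).
  by rewrite /Q /E; move: nu => c; alg_ring.
apply: (ker_add fL); last by apply: (ker_scale fL); exact: (ker_mulr fL).
apply: (ker_add fL); last exact: (ker_scale fL).
apply: ker_sub; last exact: (ker_mulr fL).
by apply: (ker_mulr fL); exact: (ker_mull fL).
Qed.

(** The constant term, as a function of [r], is the restriction of the norm form to a
    line. *)
Lemma quaternion_combination r :
  L (Q (a + r *: b) (s + r * s') (t + r ^+ 2 * t' - r * nu)) = 0.
Proof.
have E0 := quaternion_anticommutator.
have -> : Q (a + r *: b) (s + r * s') (t + r ^+ 2 * t' - r * nu) =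
    Q a s t + r ^+ 2 *: Q b s' t' + r *: E.
  by rewrite /Q /E; move: nu => c; alg_ring.
apply: (ker_add fL); last exact: (ker_scale fL).
by apply: (ker_add fL) => //; exact: (ker_scale fL).
Qed.

(** An element that does not commute with everything is not a scalar modulo the
    kernel, so it satisfies only one monic quadratic equation. *)
Lemma quadratic_unique x y r r' q q' : L (x * y - y * x) != 0 ->
  L (Q x r q) = 0 -> L (Q x r' q') = 0 -> q = q'.
Proof.
move=> xy0 Qr Qr'; suff : L ((r' - r) *: x + (q - q') *: 1) = 0.
  by move=> /(scalar_comm0 xy0)[_ /eqP]; rewrite subr_eq0 => /eqP.
have -> : (r' - r) *: x + (q - q') *: 1 = Q x r q - Q x r' q'.
  by rewrite /Q; alg_ring.
exact: ker_sub.
Qed.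

End NonCommuting.

End PairRelations.

(** * The square property gives the exact inequalities *)

Section SquareProperty.
Variables (R : realType) (U : algType R) (I : set U) (K : R) (e : nat).
Variable N : U -> R.
Hypotheses (iI : two_sided_ideal I) (qN : quasi_norm I K e N).
Hypothesis N_sqr : forall x, I x -> N (x ^+ 2) = N x ^+ 2.
Implicit Types (L : U -> R) (x y a b : U).

Let N0 x : 0 <= N x. Proof. exact: qn_ge0 qN x. Qed.
Hint Resolve N0 : core.

Definition dominated L := exists2 C, 0 <= C & forall z, I z -> L z <= C * N z.

(** Along the exponents [2 ^ j] the powers grow exactly like [N x ^+ 2 ^ j]. *)
Lemma square_growth_rate x : I x -> growth_rate N x (N x).
Proof.
move=> Ix; have [rho rho0 rate] := growth_rate_exists iI qN Ix.
have NX j : N (x ^+ (2 ^ j)) = N x ^+ (2 ^ j).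
  elim: j => [|j IHj]; first by rewrite expn0 !expr1.
  rewrite expnSr !exprM N_sqr ?IHj//.
  by apply: (ideal_exp iI) => //; rewrite expn_gt0.
have [C C0 NC] := rate.
suff -> : N x = rho by [].
have j_le m : (m <= 2 ^ m)%N by rewrite ltnW// ltn_expl.
apply/eqP; rewrite eq_le; apply/andP; split.
  apply: (@le_of_exp_le _ _ _ C 0) => // m; exists (2 ^ m)%N => //.
  by rewrite expr0 mulr1 -NX (NC _ _).2// expn_gt0.
apply: (@le_of_exp_le _ _ _ C 0) => // m; exists (2 ^ m)%N => //.
by rewrite expr0 mulr1 -NX (NC _ _).1// expn_gt0.
Qed.

(** The growth rate of [x] is the value [N x] itself, so localizing at [x] records
    this value in the lower bound for the powers of [x]. *)
Lemma pointed_localization x : I x -> N x != 0 ->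
  exists L, [/\ full_quasi_norm e L, expanding L x (N x) & dominated L].
Proof.
move=> Ix Nx0; have Nx : 0 < N x by rewrite lt_neqAle eq_sym Nx0 N0.
have rate := square_growth_rate Ix; exists (localize N x (N x)); split.
- split; first exact: (localize_quasi_norm iI qN).
  exact: (localize1_gt0 iI qN).
- exact: (localize_expanding_self iI qN).
- have [C C0 LC] := localize_le_ideal iI qN Ix Nx rate.
  by exists C => //; exact: ltW.
Qed.

Lemma dominated_subordinate L M : subordinate M L -> dominated L -> dominated M.
Proof.
move=> [[C C0 ML] _] [C' C'0 LN]; exists (C * C'); first exact: mulr_ge0.
move=> z Iz; apply: le_trans (ML z) _; rewrite -mulrA ler_wpM2l//.
exact: LN.
Qed.

Lemma expanding_le_rate L x r alpha : full_quasi_norm e L ->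
  0 <= r -> 0 <= alpha -> expanding L x r -> growth_rate L x alpha -> r <= alpha.
Proof.
move=> [[K' qL] L1] r0 al0 [eps eps0 Lx] [C C0 LC].
apply: (@le_of_exp_le _ _ _ (C / (eps * L 1)) 0) => // m; exists m.+1 => //.
have k0 : 0 < eps * L 1 by rewrite mulr_gt0.
rewrite expr0 mulr1 mulrAC ler_pdivlMr// mulrC mulrAC.
apply: le_trans (Lx _ _) _; rewrite mulr1; exact: (LC _ _).2.
Qed.

Lemma rate_le_dominated L x alpha : I x -> 0 <= alpha -> dominated L ->
  growth_rate L x alpha -> alpha <= N x.
Proof.
move=> Ix al0 [C C0 LN] [C' C'0 LC].
have [C'' C''0 NC] := square_growth_rate Ix.
apply: (@le_of_exp_le _ _ _ (C' * (C * C'')) 0) => // m; exists m.+1 => //.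
rewrite expr0 mulr1; apply: le_trans (LC _ _).1 _ => //.
rewrite -mulrA ler_wpM2l ?(ltW C'0)//.
apply: le_trans (LN _ _) _; first exact: (ideal_exp iI).
by rewrite -mulrA ler_wpM2l// (NC _ _).2.
Qed.

Lemma dominated_expr L x : I x -> full_quasi_norm e L -> dominated L ->
  exists2 C, 0 < C & forall n, L (x ^+ n) <= C * N x ^+ n.
Proof.
move=> Ix fL [C C0 LN]; have [C' C'0 NC] := square_growth_rate Ix.
have L1 : 0 < L 1 by case: fL.
exists (C * C' + L 1); first by rewrite ltr_wpDl// mulr_ge0// ltW.
case=> [|n]; first by rewrite !expr0 mulr1 lerDr mulr_ge0// ltW.
apply: le_trans (LN _ _) _; first exact: (ideal_exp iI).
apply: (@le_trans _ _ (C * (C' * N x ^+ n.+1))).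
  by rewrite ler_wpM2l// (NC _ _).2.
by rewrite mulrA ler_wpM2r ?exprn_ge0// lerDl ltW.
Qed.

Lemma quadratic_step L a : full_quasi_norm e L -> dominated L -> exists M s alpha,
  [/\ full_quasi_norm e M, subordinate M L, dominated M, 0 <= alpha &
   [/\ (I a -> alpha <= N a), (forall r, 0 <= r -> expanding L a r -> r <= alpha) &
       M (a ^+ 2 - s *: a + alpha ^+ 2 *: 1) = 0 /\
       (alpha = 0 -> M a = 0)]].
Proof.
move=> fL dL; have [M [s [alpha [fM subM al0 rate Ma]]]] := quadratic_localization a fL.
exists M, s, alpha; split=> //; first exact: dominated_subordinate dL.
split.
- by move=> Ia; exact: rate_le_dominated rate.
- by move=> r r0 ex; exact: expanding_le_rate ex rate.
- split=> // al_eq0; apply: (subordinate_ker fM subM).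
  have [C C0 /(_ 1%N isT)[_]] := rate.
  rewrite al_eq0 !expr1 mulr0 => La; apply/eqP.
  by rewrite eq_le La (full_ge0 fL).
Qed.

(** The localization at [a * b] comes first: [expanding] then retains the lower bound
    [N (a * b) ^+ n] for the powers of [a * b], while [dominated] retains the upper
    bounds for those of [a] and [b]. *)
Lemma square_submultiplicative a b : I a -> I b -> N (a * b) <= N a * N b.
Proof.
move=> Ia Ib; have Iab : I (a * b) by exact: (ideal_mulr iI).
have [->|Nab] := eqVneq (N (a * b)) 0; first by rewrite mulr_ge0.
have [L0 [fL0 ex0 dL0]] := pointed_localization Iab Nab.
have [L1 [r [xi [fL1 sub1 dL1 xi0 [_ xi_ge [Qx _]]]]]] :=
  quadratic_step (a * b) fL0 dL0.
have [L2 [s [al [fL2 sub2 dL2 al0 [/(_ Ia) al_le _ [Qa al_ker]]]]]] :=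
  quadratic_step a fL1 dL1.
have [L3 [s' [be [fL3 sub3 dL3 be0 [/(_ Ib) be_le _ [Qb _]]]]]] :=
  quadratic_step b fL2 dL2.
have [L [s'' [ga [fL sub dL _ [_ _ [Qab _]]]]]] := quadratic_step (a + b) fL3 dL3.
have sub31 := subordinate_trans sub3 sub2.
have sub41 := subordinate_trans sub sub31.
have [comm|ncomm] := eqVneq (L (a * b - b * a)) 0.
  have [[_ ex] [[K' qL] L1_gt0]] := (subordinate_trans sub41 sub1, fL).
  have {ex}[eps eps0 exL] := ex _ _ (N0 _) ex0.
  have [Ca Ca0 La] := dominated_expr Ia fL dL.
  have [Cb Cb0 Lb] := dominated_expr Ib fL dL.
  have K'0 : 0 <= K' by apply: le_trans (qn_ge1 qL).
  have k0 : 0 < eps * L 1 by rewrite mulr_gt0.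
  apply: (@le_of_exp_le _ _ _ (2 ^+ e * K' * Ca * Cb / (eps * L 1)) 0);
    rewrite ?mulr_ge0// => n.
  exists n => //; rewrite expr0 mulr1 mulrAC ler_pdivlMr// mulrC mulrAC.
  apply: le_trans (exL _ _) _; rewrite mulr1.
  apply: le_trans (le_congr fL (ker_exprM fL comm n)) _.
  rewrite -!mulrA ler_wpM2l ?exprn_ge0//.
  apply: le_trans (qnM qL _ _) _ => //; rewrite -mulrA ler_wpM2l//.
  have -> : Ca * (Cb * (N a * N b) ^+ n) = (Ca * N a ^+ n) * (Cb * N b ^+ n).
    by rewrite exprMn; ring.
  by apply: ler_pM; rewrite ?(full_ge0 fL).
have {}Qx := subordinate_ker fL sub41 Qx.
have {}Qa := subordinate_ker fL (subordinate_trans sub sub3) Qa.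
have {}Qb := subordinate_ker fL sub Qb.
have Qx' := quaternion_product fL ncomm Qa Qb Qab.
(* a does not commute with a b either: its norm al^2 is invertible, unless a is in
   the kernel *)
have aD : L (a * b * a - a * (a * b)) != 0.
  apply: contraNneq ncomm => aD0.
  have aD1 : L (a * (a * b - b * a)) = 0.
    rewrite (_ : _ * _ = - (a * b * a - a * (a * b))); first exact: (ker_opp fL).
    by alg_ring.
  have : L (al ^+ 2 *: (a * b - b * a)) = 0.
    have -> : al ^+ 2 *: (a * b - b * a) =
        (a ^+ 2 - s *: a + al ^+ 2 *: 1) * (a * b - b * a) -
        (a - s *: 1) * (a * (a * b - b * a)).
      by move: (al ^+ 2) => c; alg_ring.
    by apply: (ker_sub fL); [exact: (ker_mulr fL) | exact: (ker_mull fL)].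
  rewrite (fullZ fL) => /eqP; rewrite mulf_eq0 normr_eq0 sqrf_eq0.
  move=> /orP[/eqP al_eq0|/eqP//].
  have La : L a = 0.
    by apply: (subordinate_ker fL (subordinate_trans sub sub3)); exact: al_ker.
  by apply/eqP; apply: (ker_sub fL); [exact: (ker_mulr fL) | exact: (ker_mull fL)].
have := quadratic_unique fL aD Qx Qx'; rewrite -exprMn => xi_eq.
apply: le_trans (xi_ge _ (N0 _) ex0) _.
apply: (@le_trans _ _ (al * be)); last exact: ler_pM.
by rewrite -(@ler_pXn2r _ 2) ?nnegrE ?mulr_ge0// xi_eq.
Qed.

(** With the norm form [al^2 + r^2 be^2 - r nu] of [a + r b], the claim is
    [- nu <= 2 al be], the case [r = 1] being the norm of [a + b]. *)
Lemma square_triangle a b : I a -> I b -> N (a + b) <= N a + N b.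
Proof.
move=> Ia Ib; have Iab : I (a + b) by exact: (ideal_add iI).
have [->|Nab] := eqVneq (N (a + b)) 0; first by rewrite addr_ge0.
have [L0 [fL0 ex0 dL0]] := pointed_localization Iab Nab.
have [L1 [s'' [ga [fL1 sub1 dL1 ga0 [_ ga_ge [Qab _]]]]]] :=
  quadratic_step (a + b) fL0 dL0.
have [L2 [s [al [fL2 sub2 dL2 al0 [/(_ Ia) al_le _ [Qa _]]]]]] :=
  quadratic_step a fL1 dL1.
have [L3 [s' [be [fL3 sub3 dL3 be0 [/(_ Ib) be_le _ [Qb be_ker]]]]]] :=
  quadratic_step b fL2 dL2.
(* r minimizes the norm form on the line a + r b *)
pose nu := al ^+ 2 + be ^+ 2 - ga ^+ 2; pose r := nu / (2 * be ^+ 2).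
have [L [sz [ze [fL sub dL _ [_ _ [Qz _]]]]]] := quadratic_step (a + r *: b) fL3 dL3.
have sub41 := subordinate_trans sub (subordinate_trans sub3 sub2).
have [comm|ncomm] := eqVneq (L (a * b - b * a)) 0.
  have [[_ ex] [[K' qL] L1_gt0]] := (subordinate_trans sub41 sub1, fL).
  have {ex}[eps eps0 exL] := ex _ _ (N0 _) ex0.
  have [Ca Ca0 La] := dominated_expr Ia fL dL.
  have [Cb Cb0 Lb] := dominated_expr Ib fL dL.
  have K'0 : 0 <= K' by apply: le_trans (qn_ge1 qL).
  have k0 : 0 < eps * L 1 by rewrite mulr_gt0.
  apply: (@le_of_exp_le _ _ _ (2 ^+ e * (K' * Ca * Cb) / (eps * L 1)) e);
    rewrite ?addr_ge0// => n.
  exists n => //.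
  have -> : 2 ^+ e * (K' * Ca * Cb) / (eps * L 1) * n.+1%:R ^+ e * (N a + N b) ^+ n =
    2 ^+ e * (n.+1%:R ^+ e * (K' * Ca * Cb * (N a + N b) ^+ n)) / (eps * L 1) by ring.
  rewrite ler_pdivlMr// mulrC mulrAC.
  apply: le_trans (exL _ _) _; rewrite mulr1.
  apply: le_trans (le_congr fL (ker_binomial fL comm n)) _.
  rewrite ler_wpM2l ?exprn_ge0//.
  apply: (@qn_sum _ _ _ _ _ _ qL n
    (fun j => (('X + 1 : {poly R}) ^+ n)`_j *: (a ^+ j * b ^+ (n - j)))).
  move=> j jn; split=> //; rewrite (fullZ fL).
  have -> : (('X + 1 : {poly R}) ^+ n)`_j = 'C(n, j)%:R.
    rewrite exprD1n; under eq_bigr do rewrite -scaler_nat.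
    by rewrite -(poly_def n.+1 (fun i => 'C(n, i)%:R)) coef_poly ltnS jn.
  rewrite normr_nat.
  apply: (@le_trans _ _ ('C(n, j)%:R * (K' * (Ca * N a ^+ j) * (Cb * N b ^+ (n - j))))).
    rewrite ler_wpM2l//; apply: le_trans (qnM qL _ _) _ => //.
    by rewrite -!mulrA ler_wpM2l// mulrA ler_pM// ?(full_ge0 fL)// mulrA.
  have -> : 'C(n, j)%:R * (K' * (Ca * N a ^+ j) * (Cb * N b ^+ (n - j))) =
    K' * Ca * Cb * (N b ^+ (n - j) * N a ^+ j *+ 'C(n, j)) by rewrite -mulr_natr; ring.
  rewrite ler_wpM2l ?mulr_ge0 ?(ltW Ca0) ?(ltW Cb0)// [N a + _]addrC exprDn.
  rewrite (bigD1 (Ordinal (jn : (j < n.+1)%N)))//= lerDl sumr_ge0// => i _.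
  by rewrite mulrn_wge0// mulr_ge0 ?exprn_ge0.
have {}Qab := subordinate_ker fL sub41 Qab.
have {}Qa := subordinate_ker fL (subordinate_trans sub sub3) Qa.
have {}Qb := subordinate_ker fL sub Qb.
have be_gt0 : 0 < be.
  rewrite lt_neqAle be0 andbT; apply: contraNneq ncomm => /esym/be_ker Lb.
  have {}Lb := subordinate_ker fL sub Lb.
  by apply/eqP; apply: (ker_sub fL); [exact: (ker_mull fL) | exact: (ker_mulr fL)].
have Qz' := quaternion_combination fL ncomm Qa Qb Qab r.
have zb : L ((a + r *: b) * b - b * (a + r *: b)) != 0.
  by rewrite (_ : _ - _ = a * b - b * a)//; move: (r) => c; alg_ring.
have ze_eq := quadratic_unique fL zb Qz Qz'.
have nu_le : nu ^+ 2 <= (2 * al * be) ^+ 2.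
  have : 0 <= al ^+ 2 + r ^+ 2 * be ^+ 2 - r * nu by rewrite -ze_eq sqr_ge0.
  have -> : al ^+ 2 + r ^+ 2 * be ^+ 2 - r * nu =
      ((2 * al * be) ^+ 2 - nu ^+ 2) / (4 * be ^+ 2).
    by rewrite /r; field; rewrite lt0r_neq0.
  by rewrite pmulr_lge0 ?subr_ge0// invr_gt0 mulr_gt0// exprn_gt0.
apply: le_trans (ga_ge _ (N0 _) ex0) _.
apply: (@le_trans _ _ (al + be)); last exact: lerD.
rewrite -(@ler_pXn2r _ 2) ?nnegrE ?addr_ge0//.
have nu_ge : - nu <= 2 * al * be.
  apply: le_trans (ler_norm _) _; rewrite normrN -(@ler_pXn2r _ 2) ?nnegrE ?mulr_ge0//.
  by rewrite real_normK// num_real.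
by move: nu_ge; rewrite /nu sqrrD -mulr_natl; lra.
Qed.

End SquareProperty.

(** * Descent to the algebra *)

Section Root.
Variables (R : realType) (p : R) (p_gt0 : 0 < p).
Variables (A : lmodType R) (mul : {bilinear A -> A -> A}) (mulA : associative mul).
Variables (q : A -> R) (q_seminorm : homogeneous_seminorm p q).
Hypothesis q_square : square_property mul q.
Local Notation U := (unitization mulA).

Let embed (a : A) : U := (0, a).
Let I : set U := [set z | z.1 = 0].
Let N (z : U) : R := q z.2 `^ p^-1.
Let e := Num.bound p^-1.

Let q0 a : 0 <= q a. Proof. exact: (hseminorm_ge0 q_seminorm). Qed.
Let p0 : 0 <= p. Proof. exact: ltW. Qed.
Let V0 : 0 <= p^-1. Proof. by rewrite invr_ge0. Qed.
Let pVK (x : R) : 0 <= x -> (x `^ p) `^ p^-1 = x.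
Proof. by move=> x0; rewrite -powRrM mulfV ?lt0r_neq0// powRr1. Qed.
Let VpK (x : R) : 0 <= x -> (x `^ p^-1) `^ p = x.
Proof. by move=> x0; rewrite -powRrM mulVf ?lt0r_neq0// powRr1. Qed.

Lemma augmentation_ideal : two_sided_ideal I.
Proof.
split=> [[r a] [s b]|t [r a]|[r a] [s b]|[r a] [s b]]; rewrite /I /=.
- by move=> -> ->; rewrite addr0.
- by move=> ->; exact: mulr0.
- by move=> ->; exact: mulr0.
- by move=> ->; exact: mul0r.
Qed.

Lemma root_homog (r : R) (a : A) : q (r *: a) `^ p^-1 = `|r| * q a `^ p^-1.
Proof. by rewrite (hseminormZ q_seminorm) powRM ?powR_ge0// pVK. Qed.

Lemma seminorm_sum_le m (f : nat -> A) B : (forall i, (i <= m)%N -> q (f i) <= B) ->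
  q (\sum_(i < m.+1) f i) <= m.+1%:R * B.
Proof.
elim: m => [|m IHm] fB; first by rewrite big_ord1 mul1r fB.
rewrite big_ord_recr /=; apply: le_trans (hseminormD q_seminorm _ _) _.
rewrite -[m.+2%:R]natr1 mulrDl mul1r lerD ?fB//.
by apply: IHm => i im; rewrite fB// (leq_trans im).
Qed.

Lemma root_sum m (f : nat -> U) B :
  (forall i, (i <= m)%N -> I (f i) /\ N (f i) <= B) ->
  N (\sum_(i < m.+1) f i) <= m.+1%:R ^+ e * B.
Proof.
move=> fB; have B0 : 0 <= B by apply: le_trans (fB 0%N isT).2; exact: powR_ge0.
have -> : N (\sum_(i < m.+1) f i) = q (\sum_(i < m.+1) (f i).2) `^ p^-1.
  by rewrite /N (big_morph (fun z : U => z.2) (id1 := 0) (op1 := +%R)).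
have q_le : q (\sum_(i < m.+1) (f i).2) <= m.+1%:R * B `^ p.
  apply: (seminorm_sum_le (f := fun i => (f i).2)) => i im; rewrite -[leLHS]VpK//.
  by apply: ge0_ler_powR; rewrite ?nnegrE ?powR_ge0//; exact: (fB i im).2.
apply: (@le_trans _ _ ((m.+1%:R * B `^ p) `^ p^-1)).
  by apply: ge0_ler_powR; rewrite ?nnegrE// mulr_ge0 ?powR_ge0.
rewrite powRM ?powR_ge0// pVK// ler_wpM2r// -powR_mulrn//.
by apply: ler_powR; rewrite ?ler1n// ltW// archi_boundP.
Qed.

Lemma root_sqr z : I z -> N (z ^+ 2) = N z ^+ 2.
Proof.
case: z => [r a]; rewrite /I /N /= => ->; rewrite !scale0r !add0r q_square.
by rewrite expr2 powRM// -expr2.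
Qed.

Lemma root_submult_subadd a b :
  q (mul a b) `^ p^-1 <= q a `^ p^-1 * q b `^ p^-1 /\
  q (a + b) `^ p^-1 <= q a `^ p^-1 + q b `^ p^-1.
Proof.
have iI := augmentation_ideal.
have NZ (r : R) z : I z -> N (r *: z) = `|r| * N z by move=> _; exact: root_homog.
have [K qN] := square_quasi_norm iI (fun z => powR_ge0 _ _) NZ root_sum root_sqr.
have Ie c : I (embed c) by [].
split; last exact: (square_triangle iI qN root_sqr (Ie a) (Ie b)).
have := square_submultiplicative iI qN root_sqr (Ie a) (Ie b).
by rewrite /N /= !scale0r !add0r.
Qed.

End Root.

Theorem theorem5p1 (R : realType) (p : R) (p_gt0 : 0 < p) (p_le1 : p <= 1)
    (A : lmodType R) (mul : {bilinear A -> A -> A}) (mulA : associative mul)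
    (q : A -> R) (q_seminorm : homogeneous_seminorm p q)
    (q_square : square_property mul q) :
  submultiplicative mul q /\
  (seminorm (fun a => q a `^ p^-1) /\
   submultiplicative mul (fun a => q a `^ p^-1)).
Proof.
have root a b := root_submult_subadd p_gt0 mulA q_seminorm q_square a b.
have q0 := hseminorm_ge0 q_seminorm.
split; last split.
- move=> a b; have [ab _] := root a b.
  have pK (x : R) : 0 <= x -> (x `^ p^-1) `^ p = x.
    by move=> x0; rewrite -powRrM mulVf ?lt0r_neq0// powRr1.
  rewrite -[leLHS]pK// -[q a]pK// -[q b]pK// -powRM ?powR_ge0//.
  by apply: ge0_ler_powR; rewrite ?nnegrE ?mulr_ge0 ?powR_ge0// ltW.
- split=> [a|a b|r a]; first exact: powR_ge0.
    exact: (root a b).2.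
  by rewrite powRr1// (root_homog p_gt0 q_seminorm).
- by move=> a b; exact: (root a b).1.
Qed.
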